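(* Let $\Omega\subset\mathbb{R}^n$ be compact and $p\geq 1$. Let $f:[0,+\infty]\to[0,+\infty]$ be lower semicontinuous and convex with $f(0)=0$ and $\lim_{t\to+\infty}f(t)/t=+\infty$, and let $g:[0,1]\to[0,+\infty]$ be subadditive and lower semicontinuous with $g(0)=0$ and $\lim_{t\to0^+}g(t)/t=+\infty$. Then the minimization problem $$\min\{\mathfrak{F}^p(\mu,\nu)\ :\ \mu,\nu\in\mathcal{P}(\Omega)\}$$ has at least one solution.
   Context: $\mathcal{P}(\Omega)$ denotes the set of Borel probability measures on $\Omega$, with the weak-* topology. For $\mu,\nu\in\mathcal{P}(\Omega)$, $T_p(\mu,\nu)=\inf_\gamma\int_{\Omega\times\Omega}|x-y|^p\,d\gamma(x,y)$, the infimum being over all probability measures $\gamma$ on $\Omega\times\Omega$ with marginals $\mu$ and $\nu$. $F(\mu)=\int_\Omega f(u(x))\,dx$ if $\mu=u\cdot\mathcal{L}^n$ with $u\in L^1(\Omega)$, and $F(\mu)=+\infty$ otherwise. $G(\nu)=\sum_{i}g(a_i)$ if $\nu=\sum_{i=0}^\infty a_i\delta_{x_i}$ is purely atomic (distinct points $x_i$, $a_i\geq 0$), and $G(\nu)=+\infty$ if $\nu$ is not purely atomic. Finally $\mathfrak{F}^p(\mu,\nu)=T_p(\mu,\nu)+F(\mu)+G(\nu)$. *)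

(* Defs.v *)
From HB Require Import structures.
From mathcomp Require Import all_boot all_order all_algebra.
From mathcomp Require Import all_classical all_reals all_analysis.
Set Implicit Arguments. Unset Strict Implicit. Unset Printing Implicit Defensive.
Import Order.TTheory GRing.Theory Num.Theory.
Import numFieldNormedType.Exports.
Local Open Scope classical_set_scope.
Local Open Scope ring_scope.

Definition Rn (R : realType) (n : nat) :=
  g_sigma_algebraType (@open 'rV[R]_n).

Definition enorm (R : realType) (n : nat) (x : 'rV[R]_n) : R :=
  Num.sqrt (\sum_(i < n) (x ord0 i) ^+ 2).

Definition box (R : realType) (n : nat) (a b : 'rV[R]_n) : set (Rn R n) :=
  [set x : 'rV[R]_n | forall i, a ord0 i <= x ord0 i <= b ord0 i].

(* lam is (the Borel restriction of) the n-dimensional Lebesgue measure: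
   it gives every box its volume (this determines it uniquely on Borel sets). *)
Definition is_lebesgue (R : realType) (n : nat)
    (lam : {measure set (Rn R n) -> \bar R}) : Prop :=
  forall a b : 'rV[R]_n, (forall i, a ord0 i <= b ord0 i) ->
    lam (box a b) = (\prod_(i < n) (b ord0 i - a ord0 i))%:E.

Definition in_P (R : realType) (n : nat) (Om : set 'rV[R]_n)
    (mu : probability (Rn R n) R) : Prop :=
  mu (~` (Om : set (Rn R n))) = 0%E.

Definition coupling (R : realType) (n : nat) (mu nu : probability (Rn R n) R)
    (gam : probability (Rn R n * Rn R n)%type R) : Prop :=
  (forall A : set (Rn R n), measurable A -> gam (fst @^-1` A) = mu A) /\
  (forall B : set (Rn R n), measurable B -> gam (snd @^-1` B) = nu B).

Definition Tp (R : realType) (n : nat) (p : R) (mu nu : probability (Rn R n) R)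
  : \bar R :=
  ereal_inf [set (\int[gam]_(z in setT) ((enorm (z.1 - z.2 : 'rV[R]_n)) `^ p)%:E)%E
            | gam in [set gam | coupling mu nu gam]].

(* F(mu) = \int_Omega f(u) if mu = u L^n with u in L^1(Omega), +oo otherwise.
   Any two densities agree a.e., so taking the infimum over all densities
   yields that value (and +oo when there is no density). *)
Definition is_density (R : realType) (n : nat) (Om : set 'rV[R]_n)
    (lam : {measure set (Rn R n) -> \bar R}) (mu : probability (Rn R n) R)
    (u : Rn R n -> R) : Prop :=
  [/\ measurable_fun (Om : set (Rn R n)) u,
      (forall x, Om x -> 0 <= u x),
      lam.-integrable (Om : set (Rn R n)) (EFin \o u) &
      forall A : set (Rn R n), measurable A ->
        mu A = (\int[lam]_(x in A `&` (Om : set (Rn R n))) (u x)%:E)%E].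

Definition Ffun (R : realType) (n : nat) (Om : set 'rV[R]_n)
    (lam : {measure set (Rn R n) -> \bar R}) (f : \bar R -> \bar R)
    (mu : probability (Rn R n) R) : \bar R :=
  ereal_inf [set (\int[lam]_(x in (Om : set (Rn R n))) f (u x)%:E)%E
            | u in [set u | is_density Om lam mu u]].

(* G(nu) = sum_i g(a_i) if nu = sum_i a_i delta_{x_i} is purely atomic,
   +oo otherwise.  nu is purely atomic iff it is concentrated on its
   (countably many) atoms {x | nu{x} > 0}; the sum is taken over the atoms
   (terms with a_i = 0 contribute g(0) = 0 in the paper's convention). *)
Definition atoms (R : realType) (n : nat) (nu : probability (Rn R n) R)
  : set (Rn R n) := [set x | (0 < nu [set x])%E].

Definition Gfun (R : realType) (n : nat) (g : R -> \bar R)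
    (nu : probability (Rn R n) R) : \bar R :=
  if nu (~` atoms nu) == 0%E then
    (\esum_(x in atoms nu) g (fine (nu [set x])))%E
  else +oo%E.

Definition Fp (R : realType) (n : nat) (Om : set 'rV[R]_n) (p : R)
    (lam : {measure set (Rn R n) -> \bar R}) (f : \bar R -> \bar R)
    (g : R -> \bar R) (mu nu : probability (Rn R n) R) : \bar R :=
  (Tp p mu nu + Ffun Om lam f mu + Gfun g nu)%E.

Definition lsc_on {X : topologicalType} (R : realType) (D : set X)
    (h : X -> \bar R) : Prop :=
  forall x, D x -> forall a : R, (a%:E < h x)%E ->
    exists2 V, nbhs x V & forall y, V y -> D y -> (a%:E < h y)%E.

(* Main.v *)
Require Import Defs.
From HB Require Import structures.
From mathcomp Require Import all_boot all_order all_algebra.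
From mathcomp Require Import all_classical all_reals all_analysis.
From mathcomp Require Import measurable_realfun.
From mathcomp Require Import ring lra.
Import Order.TTheory GRing.Theory Num.Theory.
Import numFieldNormedType.Exports.
Local Open Scope classical_set_scope.
Local Open Scope ring_scope.
Set Implicit Arguments. Unset Strict Implicit. Unset Printing Implicit Defensive.

(** The infimum is attained by the direct method, with almost everywhere
convergence in place of weak topologies. A pair [(mu, nu)] of finite energy is
replaced by the plan [\sum_i (w i) L \x \d_(x i)], where [x i] is an atom of
[nu] and [w i] the density of the part of [mu] that a nearly optimal coupling
sends there; for fixed sites, transport cost and internal energy are convex in
[w]. Along a minimizing sequence the sites and the masses of the atoms converge
up to a subsequence, and no mass is lost among the atoms because [g] is steep at
0. A Komlos-type argument gives midpoint combinations of the [w] that converge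
almost everywhere: minimize the strictly convex functional
[\sum_i 2^-(i+1) \int (1 + w i)^-1] over the tails of the sequence. Fatou's lemma
passes all convex bounds to the limit, and the superlinearity of [f] keeps the
masses. Countable subadditivity of [g] covers limit atoms that collide. *)

(** * Inferior limits and series *)

Section limit_inferior.
Context (R : realType).
Implicit Types (u v : nat -> \bar R) (l : \bar R).
Local Open Scope ereal_scope.

Lemma limn_einf_ereal_sup u : limn_einf u = ereal_sup (range (einfs u)).
Proof. by rewrite limn_einf_lim; exact/cvg_lim/cvg_einfs_sup. Qed.

Lemma near_lt_limn_einf u l : l < limn_einf u -> \forall k \near \oo, l < u k.
Proof.
rewrite limn_einf_ereal_sup => /ereal_sup_gt[_ [N _ <-] lN]; exists N => // k Nk.
by apply: lt_le_trans lN _; apply: ereal_inf_lbound; exists k.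
Qed.

Lemma le_limn_einf u l : (\forall k \near \oo, l <= u k) -> l <= limn_einf u.
Proof.
move=> [N _ lN]; rewrite limn_einf_ereal_sup; apply: le_ereal_sup_tmp.
exists (einfs u N); first by exists N.
by apply: le_ereal_inf_tmp => _ [k Nk <-]; exact: lN.
Qed.

Lemma limn_einf_le u l : (\forall k \near \oo, u k <= l) -> limn_einf u <= l.
Proof.
move=> [N _ lN]; rewrite limn_einf_ereal_sup; apply: ge_ereal_sup => _ [n _ <-].
apply: le_trans (lN _ (leq_maxr n N)); apply: ereal_inf_lbound.
by exists (maxn n N) => //=; exact: leq_maxl.
Qed.

Lemma limn_einf_ge0 u : (forall k, 0 <= u k) -> 0 <= limn_einf u.
Proof. by move=> u0; apply: le_limn_einf; exact: nearW. Qed.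

Lemma limn_einf_dense u l :
  (forall a : R, a%:E < l -> \forall k \near \oo, a%:E <= u k) -> l <= limn_einf u.
Proof.
move=> near_le; have le_a (a : R) : a%:E < l -> a%:E <= limn_einf u.
  by move=> /near_le; exact: le_limn_einf.
case: l le_a {near_le} => [r| |] le_a; last by rewrite leNye.
- apply/lee_addgt0Pr => e e0; rewrite -leeBlDr// -EFinB; apply: le_a.
  by rewrite lte_fin ltrBlDr ltrDl.
- by rewrite leye_eq; apply/eqP/eqyP => a _; apply: le_a; rewrite ltry.
Qed.

Lemma limn_einfD_ge0 u v : (forall k, 0 <= u k) -> (forall k, 0 <= v k) ->
  limn_einf u + limn_einf v <= limn_einf (fun k => u k + v k).
Proof.
move=> u0 v0.
have lim0 (w : nat -> \bar R) : (forall k, 0 <= w k) -> 0 <= limn (einfs w).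
  by move=> w0; rewrite -limn_einf_lim; exact: limn_einf_ge0.
rewrite !limn_einf_lim -limeD; [|exact: is_cvg_einfs..|]; last first.
  by apply: ge0_adde_def; rewrite inE; exact: lim0.
apply: lee_lim; [|exact: is_cvg_einfs|].
  by apply: is_cvgeD; [apply: ge0_adde_def; rewrite inE; exact: lim0|exact: is_cvg_einfs..].
apply: nearW => n; apply: le_ereal_inf_tmp => _ [k nk <-].
by apply: leeD; apply: ereal_inf_lbound; exists k.
Qed.

Lemma limn_einf_sum_ge0 N (u : 'I_N -> nat -> \bar R) : (forall i k, 0 <= u i k) ->
  \sum_(i < N) limn_einf (u i) <= limn_einf (fun k => \sum_(i < N) u i k).
Proof.
elim: N u => [|N IH] u u0.
  by rewrite big_ord0; apply: le_limn_einf; apply: nearW => k; rewrite big_ord0.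
rewrite big_ord_recr /=; under [in leRHS]eq_fun do rewrite big_ord_recr /=.
apply: le_trans (limn_einfD_ge0 _ _); [|by move=> k; exact: sume_ge0|by []].
by rewrite leeD2r// IH.
Qed.

End limit_inferior.

Lemma lower_semicontinuous_limn_einf (X : topologicalType) (R : realType)
    (h : X -> \bar R) (z : nat -> X) y : lower_semicontinuous h ->
  z k @[k --> \oo] --> y -> (h y <= limn_einf (fun k => h (z k)))%E.
Proof.
move=> h_lsc zy; apply: limn_einf_dense => a /h_lsc[V yV hV].
have nearV : \forall k \near \oo, V (z k) by exact: zy yV.
by apply: filterS nearV => k /hV /ltW.
Qed.

Lemma cvge_of_near_le (R : realType) (u : nat -> \bar R) (r : R) :
  (forall e : R, 0 < e -> \forall k \near \oo, ((r - e)%:E <= u k <= (r + e)%:E)%E) ->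
  u k @[k --> \oo] --> r%:E.
Proof.
move=> near_r; have fin_num (x : \bar R) (lo hi : R) :
    (lo%:E <= x <= hi%:E)%E -> x \is a fin_num.
  move=> /andP[lox xhi]; apply: fin_real.
  by rewrite (lt_le_trans (ltNyr lo) lox) (le_lt_trans xhi (ltry hi)).
apply/fine_cvgP; split.
  by apply: filterS (near_r 1 ltr01) => k; exact: fin_num.
apply/cvgrPdist_le => e e0; apply: filterS (near_r e e0) => k ur.
by rewrite /= ler_distlC -!lee_fin fineK// (fin_num _ _ _ ur).
Qed.

Lemma lee_adde_dense (R : realType) (x y z : \bar R) : (0 <= x)%E ->
  (0 <= y)%E -> (forall r : R, (r%:E < y)%E -> (x + r%:E <= z)%E) -> (x + y <= z)%E.
Proof.
move=> x0; case: y => [s| |]// s0 xz.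
- apply/lee_addgt0Pr => e e0; rewrite -leeBlDr// -addeA -EFinB; apply: xz.
  by rewrite lte_fin ltrBlDr ltrDl.
- rewrite addey; last by rewrite -ltNye (lt_le_trans _ x0)// ltNyr.
  rewrite leye_eq; apply/eqP/eqyP => r _; apply: le_trans (xz r _); last exact: ltry.
  by rewrite leeDr.
Qed.

Lemma lt_ereal_infD (R : realType) (S : set \bar R) (y : \bar R) (c : R) :
  (forall x, S x -> (0 <= x)%E) -> (0 <= y)%E -> (ereal_inf S + y < c%:E)%E ->
  exists2 x, S x & (x + y < c%:E)%E.
Proof.
move=> S0 y0 lt_c; have infS0 : (0 <= ereal_inf S)%E by exact: le_ereal_inf_tmp.
have yfin : y \is a fin_num.
  by rewrite ge0_fin_numE// (lt_trans _ (ltry c))// (le_lt_trans _ lt_c)// leeDr.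
move: lt_c; rewrite -lteBrDr// => /ereal_inf_lt[x Sx xc].
by exists x => //; rewrite -lteBrDr.
Qed.

Lemma direct_method (R : realType) (X : Type) (A : set X) (E : X -> \bar R) :
  A !=set0 -> (forall x, (0 <= E x)%E) ->
  (forall J : R, (forall e : R, 0 < e -> exists2 x, A x & (E x < (J + e)%:E)%E) ->
    exists2 x, A x & (E x <= J%:E)%E) ->
  exists2 x, A x & forall y, A y -> (E x <= E y)%E.
Proof.
move=> [x0 Ax0] E0 attained.
have infE y : A y -> (ereal_inf (E @` A) <= E y)%E.
  by move=> Ay; apply: ereal_inf_lbound; exists y.
have : (0 <= ereal_inf (E @` A))%E by apply: le_ereal_inf_tmp => _ [x _ <-].
case inf_eq : (ereal_inf (E @` A)) infE => [J| |] infE// _; last first.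
  by exists x0 => // y /infE; rewrite leye_eq => /eqP ->; exact: leey.
have [x Ax xJ] : exists2 x, A x & (E x <= J%:E)%E.
  apply: attained => e e0; have inf_fin : ereal_inf (E @` A) \is a fin_num.
    by rewrite inf_eq.
  by have [_ [x Ax <-]] := lb_ereal_inf_adherent e0 inf_fin; rewrite inf_eq; exists x.
by exists x => // y /infE; exact: le_trans.
Qed.

Lemma cvg_partial_sum (R : realType) (a : nat -> R) (s : R) :
  (forall i, 0 <= a i) -> (\sum_(i <oo) (a i)%:E = s%:E)%E ->
  \sum_(i < N) a i @[N --> \oo] --> s.
Proof.
move=> a0 as_; have : (\sum_(0 <= i < N) (a i)%:E)%E @[N --> \oo] --> s%:E.
  by rewrite -as_; apply: is_cvg_nneseries => i _ _; rewrite lee_fin.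
move=> /fine_cvgP[_] /=; apply: cvg_trans; apply: near_eq_cvg; apply: nearW => N /=.
by rewrite sumEFin /= big_mkord.
Qed.

Lemma partial_sum_le_nneseries (R : realType) (u : nat -> \bar R) N :
  (forall i, (0 <= u i)%E) -> (\sum_(i < N) u i <= \sum_(i <oo) u i)%E.
Proof. by move=> u0; rewrite -(big_mkord xpredT u); exact: nneseries_lim_ge. Qed.

Lemma nneseries_ge_term (R : realType) (u : nat -> \bar R) i :
  (forall j, (0 <= u j)%E) -> (u i <= \sum_(j <oo) u j)%E.
Proof. by move=> u0; rewrite (nneseriesD1 (n := i))// leeDl//; exact: nneseries_ge0. Qed.

Lemma nneseries_le (R : realType) (u : nat -> \bar R) (B : \bar R) :
  (forall i, (0 <= u i)%E) -> (forall N, (\sum_(i < N) u i <= B)%E) ->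
  (\sum_(i <oo) u i <= B)%E.
Proof.
move=> u0 uB; apply: lime_le; first by apply: is_cvg_nneseries.
by apply: nearW => N; rewrite big_mkord.
Qed.

Lemma nneseries_le_limn_einf (R : realType) (u : nat -> \bar R) :
  (forall i, (0 <= u i)%E) ->
  (\sum_(i <oo) u i <= limn_einf (fun N => \sum_(i < N) u i)%E)%E.
Proof.
move=> u0; under [in leRHS]eq_fun do rewrite -(big_mkord xpredT u).
have u_cvg : cvgn (fun N => \sum_(0 <= i < N) u i)%E by exact: is_cvg_nneseries.
by rewrite (cvg_limn_einf_sup u_cvg).1.
Qed.

(** * Integrals and densities *)

Definition nonneg_measurable d (T : measurableType d) (R : realType) (u : T -> R) :=
  measurable_fun setT u /\ forall x, 0 <= u x.

Section integral_lemmas.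
Context d (T : measurableType d) (R : realType) (mu : {measure set T -> \bar R}).
Implicit Types (u v : T -> R) (h k : T -> \bar R).
Local Open Scope ereal_scope.

Lemma nonneg_measurable_EFin u : nonneg_measurable u ->
  measurable_fun setT (EFin \o u) /\ forall x, 0 <= (u x)%:E.
Proof. by move=> [mu_ u0]; split=> [|x]; [exact/measurable_EFinP|rewrite lee_fin]. Qed.

Lemma integral_le_limn_einf (F : nat -> T -> \bar R) h :
  (forall n, measurable_fun setT (F n)) -> (forall n x, 0 <= F n x) ->
  measurable_fun setT h -> (forall x, 0 <= h x) ->
  {ae mu, forall x, h x <= limn_einf (F ^~ x)} ->
  \int[mu]_x h x <= limn_einf (fun n => \int[mu]_x F n x).
Proof.
move=> mF F0 mh h0 hF.
apply: le_trans (fatou mu measurableT mF (fun n x _ => F0 n x)).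
apply: ae_ge0_le_integral => //.
- by move=> x _; exact: limn_einf_ge0.
- apply: measurableT_comp => //; apply: measurable_fun_limn_esup => n.
  exact: measurableT_comp.
- by apply: filterS hF => x hFx _.
Qed.

Lemma ge0_integrable h : measurable_fun setT h -> (forall x, 0 <= h x) ->
  \int[mu]_x h x < +oo -> mu.-integrable setT h.
Proof.
by move=> mh h0 h_lty; apply/integrableP; split=> //; under eq_integral do rewrite gee0_abs//.
Qed.

Lemma integral_lty_ae_fin_num h : measurable_fun setT h -> (forall x, 0 <= h x) ->
  \int[mu]_x h x < +oo -> {ae mu, forall x, h x \is a fin_num}.
Proof.
by move=> mh h0 /(ge0_integrable mh h0)/(integrable_ae measurableT); apply: filterS => x /(_ I).
Qed.

Lemma ge0_integral_half h k : measurable_fun setT h -> measurable_fun setT k ->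
  (forall x, 0 <= h x) -> (forall x, 0 <= k x) ->
  \int[mu]_x ((h x + k x) * (2^-1)%:E) =
  (\int[mu]_x h x + \int[mu]_x k x) * (2^-1)%:E.
Proof.
move=> mh mk h0 k0; rewrite -ge0_integralD// -ge0_integralZr//.
- exact: emeasurable_funD.
- by move=> x _; rewrite adde_ge0.
Qed.

Lemma ge0_integral_mrestr (D : set T) (mD : measurable D) h :
  measurable_fun setT h -> (forall x, 0 <= h x) ->
  \int[mrestr mu mD]_x h x = \int[mu]_(x in D) h x.
Proof.
move=> mh h0.
have null_setC : mrestr mu mD (~` D) = 0 by rewrite /mrestr setICl measure0.
rewrite [LHS](ge0_negligible_integral (measurableC mD))// setTD setCK.
by apply: eq_measure_integral => A mA AD; rewrite /= /mrestr setIidl.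
Qed.

Lemma ge0_integral_mrestr_in (D A : set T) (mD : measurable D) h :
  measurable A -> measurable_fun setT h -> (forall x, 0 <= h x) ->
  \int[mrestr mu mD]_(x in A) h x = \int[mu]_(x in A `&` D) h x.
Proof.
move=> mA mh h0; rewrite [LHS]integral_mkcond ge0_integral_mrestr.
- by rewrite -integral_mkcondr setIC.
- by apply/(measurable_restrictT _ mA); exact: measurable_funTS.
- by move=> x; rewrite patchE; case: ifP.
Qed.

End integral_lemmas.

Section density_measure.
Context d (T : measurableType d) (R : realType).
Variables (mu : {measure set T -> \bar R}) (w : T -> R).
Hypotheses (nw : nonneg_measurable w) (w_lty : (\int[mu]_x (w x)%:E < +oo)%E).

Definition density_measure of nonneg_measurable w & (\int[mu]_x (w x)%:E < +oo)%E :=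
  fun A : set T => (\int[mu]_(x in A) (w x)%:E)%E.

Local Notation nu := (density_measure nw w_lty).

Let density0 : nu set0 = 0%E. Proof. exact: integral_set0. Qed.

Let density_ge0 A : (0 <= nu A)%E.
Proof. by apply: integral_ge0 => x _; rewrite lee_fin; have [_] := nw. Qed.

Let density_sigma_additive : semi_sigma_additive nu.
Proof.
by have [mw w0] := nonneg_measurable_EFin nw; exact: semi_sigma_additive_nng_induced.
Qed.

HB.instance Definition _ :=
  isMeasure.Build d T R nu density0 density_ge0 density_sigma_additive.

Let density_finite : fin_num_fun nu.
Proof.
have [mw w0] := nonneg_measurable_EFin nw.
move=> A mA; rewrite ge0_fin_numE//; apply: le_lt_trans w_lty.
exact: ge0_subset_integral.
Qed.

HB.instance Definition _ := Measure_isFinite.Build d T R nu density_finite.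

End density_measure.

(* Both densities of [nu], the given one and the Radon-Nikodym derivative, agree
   almost everywhere, and the change of variables is known for the latter. *)
Lemma ge0_integral_density d (T : measurableType d) (R : realType)
    (mu nu : {finite_measure set T -> \bar R}) (w : T -> R) (h : T -> \bar R) :
  nonneg_measurable w ->
  (forall A, measurable A -> nu A = (\int[mu]_(x in A) (w x)%:E)%E) ->
  measurable_fun setT h -> (forall x, (0 <= h x)%E) ->
  (\int[nu]_x h x = \int[mu]_x (h x * (w x)%:E))%E.
Proof.
move=> /nonneg_measurable_EFin[mw w0] nuE mh h0.
have nu_mu : nu `<< mu.
  apply/null_content_dominatesP => A mA muA; rewrite nuE//.
  by apply: null_set_integral => //; exact: measurable_funTS.
rewrite -(Radon_Nikodym_SigmaFinite.change_of_variables nu_mu)//.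
set rn := Radon_Nikodym_SigmaFinite.f nu mu.
have rn_int : mu.-integrable setT rn.
  exact: Radon_Nikodym_SigmaFinite.f_integrable.
have mrn := measurable_int _ rn_int.
have rn_w : ae_eq mu setT rn (EFin \o w).
  apply: integral_ae_eq => // A _ mA; rewrite -nuE//.
  by rewrite -Radon_Nikodym_SigmaFinite.f_integral.
apply: ge0_ae_eq_integral => //.
- exact: emeasurable_funM.
- exact: emeasurable_funM.
- by move=> x _; rewrite mule_ge0// Radon_Nikodym_SigmaFinite.f_ge0.
- by move=> x _; rewrite mule_ge0.
- by apply: filterS rn_w => x + _ => ->.
Qed.

(** * Forward midpoints *)

Section midpoint_hull.
Context (V : Type) (mid : V -> V -> V) (w : nat -> V).

Inductive midhull (k : nat) : V -> Prop :=
| midhull_tail m : (k <= m)%N -> midhull k (w m)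
| midhull_mid u v : midhull k u -> midhull k v -> midhull k (mid u v).

Lemma midhull_le k l u : (k <= l)%N -> midhull l u -> midhull k u.
Proof.
move=> kl; elim=> [m lm|u1 u2 _ IH1 _ IH2]; last exact: midhull_mid.
by apply: midhull_tail; exact: leq_trans lm.
Qed.

Lemma midhull_near (P : V -> Prop) : (forall u v, P u -> P v -> P (mid u v)) ->
  (\forall m \near \oo, P (w m)) -> \forall k \near \oo, forall u, midhull k u -> P u.
Proof.
move=> Pmid [N _ PN]; exists N => // k /= Nk u.
elim=> [m km|u1 u2 _ IH1 _ IH2]; last exact: Pmid.
by apply: PN => /=; exact: leq_trans km.
Qed.

Section almost_minimizers.
Context (R : realType) (J : V -> R) (C : R).
Hypothesis J_itv : forall u, midhull 0 u -> 0 <= J u <= C.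

Let J_ge0 k u : midhull k u -> 0 <= J u.
Proof. by move=> /(midhull_le (leq0n k))/J_itv/andP[]. Qed.

Let infJ k : R := inf [set J u | u in midhull k].

Let infJ_lb k u : midhull k u -> infJ k <= J u.
Proof.
by move=> ku; apply: ge_inf; [exists 0 => _ [v /J_ge0 v0 <-]|exists u].
Qed.

Let infJ_adherent k e : 0 < e -> exists2 u, midhull k u & J u < infJ k + e.
Proof.
move=> e0; have Jinf : has_inf [set J u | u in midhull k].
  split; first by exists (J (w k)), (w k) => //; exact: midhull_tail.
  by exists 0 => _ [v /J_ge0 v0 <-].
by have [_ [u ku <-] Ju] := inf_adherent e0 Jinf; exists u.
Qed.

Let infJ_le k l : (k <= l)%N -> infJ k <= infJ l.
Proof.
move=> kl; apply: lb_le_inf; first by exists (J (w l)), (w l) => //; exact: midhull_tail.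
by move=> _ [u lu <-]; apply: infJ_lb; exact: midhull_le lu.
Qed.

Let has_sup_infJ : has_sup (range infJ).
Proof.
split; first by exists (infJ 0), 0%N.
exists C => _ [k _ <-]; apply: le_trans (infJ_lb (midhull_tail (leqnn k))) _.
by have /andP[] := J_itv (midhull_tail (leq0n k)).
Qed.

(* A midpoint of two almost minimizers over tails cannot beat the infimum over
   the longer tail, so [J] is almost affine between them. *)
Lemma midhull_small_defect (eps : nat -> R) :
  (forall l, 0 < eps l) -> (forall l, eps l.+1 <= eps l) ->
  exists v : nat -> V, (forall l, midhull l (v l)) /\
    forall l, J (v l) + J (v l.+1) - J (mid (v l) (v l.+1)) *+ 2 <= eps l.
Proof.
move=> eps0 eps_le; pose s := sup (range infJ).
have d0 l : 0 < eps l / 4 by rewrite divr_gt0.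
have /choice[v v_min] l : exists u, exists K,
    [/\ (l <= K)%N, midhull K u, s - eps l / 4 < infJ K & J u < s + eps l / 4].
  have [_ [k _ <-] sk] := sup_adherent (d0 l) has_sup_infJ.
  have [u ku Ju] := infJ_adherent (maxn k l) (d0 l).
  exists u, (maxn k l); split => //; first exact: leq_maxr.
    by apply: lt_le_trans sk _; apply: infJ_le; exact: leq_maxl.
  apply: lt_le_trans Ju _; rewrite lerD2r.
  by apply: ub_le_sup; [case: has_sup_infJ|exists (maxn k l)].
exists v; split=> l; first by have [K [lK Kv _ _]] := v_min l; exact: midhull_le Kv.
have [K [_ Kv sK Jv]] := v_min l; have [K' [_ K'v sK' Jv']] := v_min l.+1.
have /infJ_lb Jmid : midhull (minn K K') (mid (v l) (v l.+1)).
  by apply: midhull_mid; [exact: midhull_le (geq_minl _ _) Kv|exact: midhull_le (geq_minr _ _) K'v].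
have s_mid : s - eps l / 4 < infJ (minn K K').
  rewrite /minn; case: ifP => _ //; apply: le_lt_trans sK'.
  by rewrite lerB// ler_pM2r ?invr_gt0.
have := eps_le l; move: Jmid s_mid Jv Jv'; rewrite mulr2n.
by move: (J _) (infJ _) (J _) (J _) => Jm jm J1 J2; lra.
Qed.

End almost_minimizers.
End midpoint_hull.

Section bounded_convex_function.
Context (R : realType).
Implicit Types s t : R.

Definition inv1D t : R := (1 + t)^-1.

Lemma inv1D_ge0 t : 0 <= t -> 0 <= inv1D t.
Proof. by move=> t0; rewrite invr_ge0 addr_ge0. Qed.

Lemma inv1D_le1 t : 0 <= t -> inv1D t <= 1.
Proof. by move=> t0; rewrite invf_le1 ?lerDl// ltr_pwDl. Qed.

Lemma inv1D_midpoint s t : 0 <= s -> 0 <= t ->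
  inv1D ((s + t) / 2) + inv1D ((s + t) / 2) + (inv1D s - inv1D t) ^+ 2 / 2 <=
  inv1D s + inv1D t.
Proof.
move=> s0 t0; rewrite /inv1D; pose a := 1 + s; pose b := 1 + t.
have [a1 b1] : 1 <= a /\ 1 <= b by rewrite !lerDl.
have [a0 b0] : 0 < a /\ 0 < b by rewrite !(lt_le_trans ltr01).
have -> : 1 + (s + t) / 2 = (a + b) / 2 by rewrite /a /b; field.
rewrite -/a -/b -subr_ge0.
have -> : a^-1 + b^-1 - (((a + b) / 2)^-1 + ((a + b) / 2)^-1 +
    (a^-1 - b^-1) ^+ 2 / 2) =
  (a - b) ^+ 2 / (2 * (a ^+ 2 * b ^+ 2 * (a + b))) * (a * (b - 1) + b * (a - 1)).
  by field; rewrite !gt_eqF// addr_gt0.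
by rewrite mulr_ge0// ?divr_ge0 ?sqr_ge0// ?addr_ge0// !mulr_ge0 ?sqr_ge0 ?subr_ge0 ?addr_ge0// ltW.
Qed.

Lemma measurable_inv1D d (T : measurableType d) (u : T -> R) :
  nonneg_measurable u -> nonneg_measurable (fun x => inv1D (u x)).
Proof.
move=> [mu u0]; split=> [|x]; last exact: inv1D_ge0.
have -> : (fun x => inv1D (u x)) = fun x => (1 + u x) `^ (-1).
  by apply/funext => x; rewrite powR_inv1// addr_ge0.
by apply: (measurableT_comp (measurable_powR _)); exact: measurable_funD.
Qed.

Lemma cvg_of_inv1D (s : nat -> R) : (forall l, 0 <= s l) ->
  cvgn (fun l => inv1D (s l)) -> (limn_einf (fun l => (s l)%:E) < +oo)%E -> cvgn s.
Proof.
move=> s0 /cvg_ex[b sb] s_lty.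
have : 0 <= b.
  rewrite -(cvg_lim (@Rhausdorff R) sb); apply: limr_ge; first by apply/cvg_ex; exists b.
  by apply: nearW => l; exact: inv1D_ge0.
rewrite le_eqVlt => /predU1P[b0|b0].
  have : (+oo <= limn_einf (fun l => (s l)%:E))%E.
    apply: limn_einf_dense => a _.
    have a1 : 0 < inv1D `|a| by rewrite invr_gt0 ltr_pwDl.
    move/cvgrPdist_lt : sb => /(_ _ a1); apply: filterS => l.
    rewrite -b0 sub0r normrN ger0_norm ?inv1D_ge0//.
    have pos1D t : 0 <= t -> 1 + t \is Num.pos by move=> t0; rewrite posrE ltr_pwDl.
    rewrite ltf_pV2 ?pos1D// ltrD2l lee_fin => /ltW.
    exact/le_trans/ler_norm.
  by rewrite leNgt s_lty.
have -> : s = fun l => (inv1D (s l))^-1 - 1.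
  by apply/funext => l; rewrite invrK addrC addKr.
apply/cvg_ex; exists (b^-1 - 1); apply: cvgB; last exact: cvg_cst.
by apply: cvgV => //; rewrite gt_eqF.
Qed.

End bounded_convex_function.

Lemma geometric_cvgn (R : realType) (u : nat -> R) (C : R) :
  (forall k, `|u k.+1 - u k| <= C / 2 ^+ k) -> cvgn u.
Proof.
move=> u_geo; have : cvgn (series (telescope u)).
  apply: normed_cvg; apply: (@series_le_cvg _ _ (geometric C 2^-1)).
  - by move=> k /=; exact: normr_ge0.
  - by move=> k; rewrite /geometric /= exprVn; apply: le_trans (u_geo k).
  - by move=> k /=; rewrite exprVn; exact: u_geo.
  - by apply: is_cvg_geometric_series; rewrite ger0_norm// invf_lt1// ltr1n.
move=> /cvg_ex[l ul]; apply/cvg_ex; exists (u 0%N + l).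
have uE : (fun k => u 0%N + series (telescope u) k) = u.
  by apply/funext => k; exact/esym/eq_sum_telescope.
by rewrite -[X in X @ _]uE; apply: cvgD => //; exact: cvg_cst.
Qed.

Lemma ae_cvgn_of_integral_sqr d (T : measurableType d) (R : realType)
    (mu : {measure set T -> \bar R}) (g : nat -> T -> R) (C : R) :
  (forall l, measurable_fun setT (g l)) ->
  (forall l, \int[mu]_x ((g l.+1 x - g l x) ^+ 2)%:E <= (C / 8 ^+ l)%:E)%E ->
  {ae mu, forall x, cvgn (g ^~ x)}.
Proof.
move=> mg gC; pose q l x : \bar R := (4 ^+ l * (g l.+1 x - g l x) ^+ 2)%:E.
have q0 l x : (0 <= q l x)%E by rewrite lee_fin mulr_ge0 ?sqr_ge0 ?exprn_ge0.
have mq l : measurable_fun setT (q l).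
  apply/measurable_EFinP/measurable_funM => //.
  by apply: measurable_funX; exact: measurable_funB.
have C0 : 0 <= C.
  rewrite -[C]divr1 -(expr0 8) -lee_fin; apply: le_trans (gC 0%N).
  by apply: integral_ge0 => x _; rewrite lee_fin sqr_ge0.
have int_q l : (\int[mu]_x q l x <= (C * 2 / (2 ^ l.+1)%:R)%:E)%E.
  under eq_integral do rewrite /q EFinM.
  rewrite ge0_integralZl//; last 2 first.
  - by apply/measurable_EFinP/measurable_funX; exact: measurable_funB.
  - by move=> x _; rewrite lee_fin sqr_ge0.
  apply: (@le_trans _ _ ((4 ^+ l)%:E * (C / 8 ^+ l)%:E)%E).
    by rewrite lee_wpmul2l// lee_fin exprn_ge0.
  rewrite -EFinM lee_fin natrX exprS (_ : 8 = 4 * 2 :> R); last by rewrite -natrM.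
  by rewrite exprMn le_eqVlt; apply/orP; left; apply/eqP; field; rewrite !expf_neq0.
have : {ae mu, forall x, (\sum_(l <oo) q l x)%E \is a fin_num}.
  apply: integral_lty_ae_fin_num.
  - by apply: ge0_emeasurable_sum.
  - by move=> x; apply: nneseries_ge0.
  rewrite integral_nneseries//; apply: (@le_lt_trans _ _ (C * 2)%:E); last exact: ltry.
  apply: le_trans (epsilon_trick0 xpredT (mulr_ge0 C0 (ler0n R 2))).
  by apply: lee_nneseries => l _; [move=> _; exact: integral_ge0|exact: int_q].
apply: filterS => x qfin; pose S := fine (\sum_(l <oo) q l x)%E.
apply: (geometric_cvgn (C := Num.sqrt S)) => l.
rewrite ler_pdivlMr ?exprn_gt0// -[X in _ * X]ger0_norm ?exprn_ge0// -normrM.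
rewrite -sqrtr_sqr ler_wsqrtr// exprMn -exprM mulnC exprM -natrX mulrC -lee_fin fineK//.
exact: (nneseries_ge_term (u := q ^~ x)).
Qed.

Section forward_midpoints.
Context d (T : measurableType d) (R : realType) (L : {finite_measure set T -> \bar R}).
Implicit Types (u v : nat -> T -> R) (i : nat).

Definition nonneg_family u := forall i, nonneg_measurable (u i).

Definition family_mid u v i x := (u i x + v i x) / 2.

Lemma nonneg_family_mid u v : nonneg_family u -> nonneg_family v ->
  nonneg_family (family_mid u v).
Proof.
move=> nu nv i; have [mu u0] := nu i; have [mv v0] := nv i; split=> [|x].
  by apply: measurable_funM => //; exact: measurable_funD.
by rewrite divr_ge0// addr_ge0.
Qed.

Lemma integral_family_mid u v i : nonneg_family u -> nonneg_family v ->
  (\int[L]_x (family_mid u v i x)%:E =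
   (\int[L]_x (u i x)%:E + \int[L]_x (v i x)%:E) * (2^-1)%:E)%E.
Proof.
move=> /(_ i)/nonneg_measurable_EFin[mu u0] /(_ i)/nonneg_measurable_EFin[mv v0].
by rewrite -ge0_integral_half.
Qed.

Let inv1D_integral u i := (\int[L]_x (inv1D (u i x))%:E)%E.

Let inv1D_integral_ge0 u i : nonneg_family u -> (0 <= inv1D_integral u i)%E.
Proof.
move=> /(_ i)/measurable_inv1D/nonneg_measurable_EFin[_ phi0].
by apply: integral_ge0.
Qed.

Let inv1D_integral_le u i : nonneg_family u -> (inv1D_integral u i <= L setT)%E.
Proof.
move=> nu; have [mphi phi0] := nonneg_measurable_EFin (measurable_inv1D (nu i)).
rewrite -[leRHS]mul1e -integral_cst//; apply: ge0_le_integral => // x _.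
by have [_ u0] := nu i; rewrite lee_fin inv1D_le1.
Qed.

Let inv1D_integral_mid u v i : nonneg_family u -> nonneg_family v ->
  (inv1D_integral (family_mid u v) i + inv1D_integral (family_mid u v) i +
   \int[L]_x ((inv1D (u i x) - inv1D (v i x)) ^+ 2 / 2)%:E <=
   inv1D_integral u i + inv1D_integral v i)%E.
Proof.
move=> nu nv; have nm := nonneg_family_mid nu nv.
have [mu u0] := nonneg_measurable_EFin (measurable_inv1D (nu i)).
have [mv v0] := nonneg_measurable_EFin (measurable_inv1D (nv i)).
have [mm m0] := nonneg_measurable_EFin (measurable_inv1D (nm i)).
have mdiff : measurable_fun setT
    (fun x => ((inv1D (u i x) - inv1D (v i x)) ^+ 2 / 2)%:E).
  apply/measurable_EFinP/measurable_funM => //; apply: measurable_funX.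
  by apply: measurable_funB; exact/measurable_EFinP.
have diff0 x : (0 <= ((inv1D (u i x) - inv1D (v i x)) ^+ 2 / 2)%:E)%E.
  by rewrite lee_fin divr_ge0// sqr_ge0.
rewrite -!ge0_integralD//; last 2 first.
- by move=> x _; rewrite adde_ge0.
- exact: emeasurable_funD.
apply: ge0_le_integral => //.
- by move=> x _; rewrite !adde_ge0.
- by apply: emeasurable_funD => //; exact: emeasurable_funD.
- exact: emeasurable_funD.
- move=> x _; rewrite -!EFinD lee_fin; have [_ ux0] := nu i; have [_ vx0] := nv i.
  exact: inv1D_midpoint.
Qed.

Let weight i : R := ((2 ^ i.+1)%:R)^-1.

Let weight_ge0 i : (0 <= (weight i)%:E)%E.
Proof. by rewrite lee_fin invr_ge0. Qed.

Let weighted_inv1D u := (\sum_(i <oo) (weight i)%:E * inv1D_integral u i)%E.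

Let weighted_inv1D_term_ge0 u i : nonneg_family u ->
  (0 <= (weight i)%:E * inv1D_integral u i)%E.
Proof. by move=> nu; rewrite mule_ge0// inv1D_integral_ge0. Qed.

Let weighted_inv1D_le u : nonneg_family u -> (weighted_inv1D u <= L setT)%E.
Proof.
move=> nu; have Lfin : L setT \is a fin_num by rewrite fin_num_measure.
rewrite -(fineK Lfin); apply: le_trans (epsilon_trick0 xpredT (fine_ge0 (measure_ge0 L setT))).
apply: lee_nneseries => i _; first by move=> _; exact: weighted_inv1D_term_ge0.
by rewrite EFinM fineK// muleC lee_wpmul2r// inv1D_integral_le.
Qed.

Let J u : R := fine (weighted_inv1D u).

Let JE u : nonneg_family u -> weighted_inv1D u = (J u)%:E.
Proof.
move=> nu; rewrite fineK// ge0_fin_numE.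
  by apply: le_lt_trans (weighted_inv1D_le nu) _; rewrite ltey_eq fin_num_measure.
by apply: nneseries_ge0 => i _ _; exact: weighted_inv1D_term_ge0.
Qed.

Let J_itv u : nonneg_family u -> 0 <= J u <= fine (L setT).
Proof.
move=> nu; rewrite -!lee_fin -JE// fineK ?fin_num_measure// weighted_inv1D_le// andbT.
by apply: nneseries_ge0 => i _ _; exact: weighted_inv1D_term_ge0.
Qed.

Let J_defect u v i : nonneg_family u -> nonneg_family v ->
  ((weight i)%:E * \int[L]_x ((inv1D (u i x) - inv1D (v i x)) ^+ 2 / 2)%:E <=
   (J u + J v - J (family_mid u v) *+ 2)%:E)%E.
Proof.
move=> nu nv; have nm := nonneg_family_mid nu nv.
pose D j := ((weight j)%:E * \int[L]_x ((inv1D (u j x) - inv1D (v j x)) ^+ 2 / 2)%:E)%E.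
have D0 j : (0 <= D j)%E.
  by rewrite mule_ge0//; apply: integral_ge0 => x _; rewrite lee_fin divr_ge0// sqr_ge0.
rewrite EFinB mulr2n leeBrDl// !EFinD -!JE//.
apply: (@le_trans _ _ (weighted_inv1D (family_mid u v) +
    weighted_inv1D (family_mid u v) + \sum_(j <oo) D j)%E).
  by rewrite leeD2l//; exact: nneseries_ge_term.
have term0 := weighted_inv1D_term_ge0.
rewrite -!nneseriesD//; try by move=> j _; rewrite ?adde_ge0// term0.
apply: lee_nneseries => j _; first by move=> _; rewrite !adde_ge0// term0.
have [u0 v0 m0] : [/\ 0 <= inv1D_integral u j, 0 <= inv1D_integral v j &
    0 <= inv1D_integral (family_mid u v) j]%E by split; exact: inv1D_integral_ge0.
rewrite -!ge0_muleDr//; [|exact: adde_ge0|].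
  by rewrite lee_wpmul2l// inv1D_integral_mid.
by apply: integral_ge0 => x _; rewrite lee_fin divr_ge0// sqr_ge0.
Qed.

Variables (w : nat -> nat -> T -> R) (B : nat -> R).
Hypothesis nw : forall m, nonneg_family (w m).
Hypothesis wB : forall m i, (\int[L]_x (w m i x)%:E <= (B i)%:E)%E.

Local Notation hull := (midhull family_mid w).

Lemma nonneg_family_midhull k u : hull k u -> nonneg_family u.
Proof. by elim=> [m _|u1 u2 _ n1 _ n2]; [exact: nw|exact: nonneg_family_mid]. Qed.

Let integral_midhull_le k u i : hull k u -> (\int[L]_x (u i x)%:E <= (B i)%:E)%E.
Proof.
elim=> [m _|u1 u2 h1 IH1 h2 IH2]; first exact: wB.
rewrite integral_family_mid; [|exact: nonneg_family_midhull h1|exact: nonneg_family_midhull h2].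
by rewrite (splitr (B i)) -mulrDl EFinM lee_wpmul2r ?lee_fin// EFinD leeD.
Qed.

Lemma midhull_cvg_inv1D : exists v : nat -> nat -> T -> R,
  (forall l, hull l (v l)) /\
  {ae L, forall x i, cvgn (fun l => inv1D (v l i x))}.
Proof.
have J_hull u : hull 0 u -> 0 <= J u <= fine (L setT).
  by move=> /nonneg_family_midhull/J_itv.
have eps0 l : 0 < (8 ^+ l)^-1 :> R by rewrite invr_gt0 exprn_gt0.
have eps_le l : (8 ^+ l.+1)^-1 <= (8 ^+ l)^-1 :> R.
  by rewrite lef_pV2 ?posrE ?exprn_gt0// ler_weXn2l// ler1n.
have [v [hv defect]] := midhull_small_defect J_hull eps0 eps_le.
have nv l : nonneg_family (v l) by exact: nonneg_family_midhull (hv l).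
exists v; split=> //; apply/ae_foralln => i.
apply: (ae_cvgn_of_integral_sqr (C := 2 / weight i)) => l.
  by have [] := measurable_inv1D (nv l i).
set I := (X in (X <= _)%E); have I_defect : ((weight i)%:E * (I * (2^-1)%:E) <= (8 ^+ l)^-1%:E)%E.
  rewrite -ge0_integralZr//; last 2 first.
  - apply/measurable_EFinP/measurable_funX; apply: measurable_funB.
    + by have [] := measurable_inv1D (nv l.+1 i).
    + by have [] := measurable_inv1D (nv l i).
  - by move=> x _; rewrite lee_fin sqr_ge0.
  under eq_integral do rewrite -EFinM -sqrrN opprB.
  by apply: le_trans (J_defect i (nv l) (nv l.+1)) _; rewrite lee_fin.
have weight0 : 0 < weight i by rewrite invr_gt0 ltr0n expn_gt0.
have -> : I = ((2 / weight i)%:E * ((weight i)%:E * (I * (2^-1)%:E)))%E.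
  by rewrite muleA -EFinM divfK ?gt_eqF// muleCA -EFinM divff// mule1.
by rewrite [leRHS]EFinM lee_wpmul2l// lee_fin divr_ge0// ltW.
Qed.

Lemma midhull_ae_cvg : exists v : nat -> nat -> T -> R, exists v_lim : nat -> T -> R,
  [/\ forall l, hull l (v l), nonneg_family v_lim &
      {ae L, forall x i, v l i x @[l --> \oo] --> v_lim i x}].
Proof.
have [v [hv cvg_phi]] := midhull_cvg_inv1D.
have nv l : nonneg_family (v l) by exact: nonneg_family_midhull (hv l).
have vE l i := nonneg_measurable_EFin (nv l i).
pose li i x := limn_einf (fun l => (v l i x)%:E).
have mli i : measurable_fun setT (li i).
  apply: measurableT_comp => //; apply: measurable_fun_limn_esup => l.
  by apply: measurableT_comp => //; have [] := vE l i.
have li0 i x : (0 <= li i x)%E.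
  by apply: limn_einf_ge0 => l; have [_] := vE l i.
have li_fin : {ae L, forall x i, li i x \is a fin_num}.
  apply/ae_foralln => i; apply: integral_lty_ae_fin_num => //.
  apply: (@le_lt_trans _ _ (B i)%:E); last exact: ltry.
  apply: (@le_trans _ _ (limn_einf (fun l => \int[L]_x (v l i x)%:E))%E).
    apply: integral_le_limn_einf => //; try by move=> l; have [] := vE l i.
    by apply: aeW => x; exact: lexx.
  by apply: limn_einf_le; apply: nearW => l; exact: integral_midhull_le (hv l).
exists v, (fun i x => fine (li i x)); split => //.
  by move=> i; split=> [|x]; [exact: measurableT_comp|exact: fine_ge0].
apply: filterS2 cvg_phi li_fin => x cphi fin_x i.
have /cvg_ex[r vr] : cvgn (fun l => v l i x).
  apply: cvg_of_inv1D (cphi i) _; first by move=> l; have [_] := nv l i.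
  by rewrite ltey_eq fin_x.
suff -> : li i x = r%:E by [].
have vrE : (v l i x)%:E @[l --> \oo] --> r%:E by apply: cvg_EFin => //; exact: nearW.
by rewrite /li (cvg_limn_einf_sup vrE).1.
Qed.

End forward_midpoints.
Arguments family_mid {d T R}.

(** * Convex integrands and superlinear bounds *)

Section convex_integrands.
Context d (T : measurableType d) (R : realType) (L : {finite_measure set T -> \bar R}).
Implicit Types (G : T -> (nat -> R) -> \bar R) (x : T) (y : nat -> R).

Record convex_integrand G : Prop := ConvexIntegrand {
  convex_integrand_ge0 : forall x y, (forall i, 0 <= y i) -> (0 <= G x y)%E;
  convex_integrand_mid : forall x y y', (forall i, 0 <= y i) -> (forall i, 0 <= y' i) ->
    (G x (fun i => (y i + y' i) / 2)%R <= (G x y + G x y') * (2^-1)%:E)%E;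
  convex_integrand_lsc : forall x (z : nat -> nat -> R) y, (forall l i, 0 <= z l i) ->
    (forall i, z l i @[l --> \oo] --> y i) -> (G x y <= limn_einf (fun l => G x (z l)))%E;
  measurable_convex_integrand : forall u : nat -> T -> R, nonneg_family u ->
    measurable_fun setT (fun x => G x (u ^~ x)) }.

Variables (G : T -> (nat -> R) -> \bar R).
Hypothesis convG : convex_integrand G.

Let G_ge0 (u : nat -> T -> R) x : nonneg_family u -> (0 <= G x (u ^~ x))%E.
Proof. by move=> nu; apply: convex_integrand_ge0 => // i; have [_] := nu i. Qed.

Lemma integral_convex_mid_le u v (B : R) : nonneg_family u -> nonneg_family v ->
  (\int[L]_x G x (u ^~ x) <= B%:E)%E -> (\int[L]_x G x (v ^~ x) <= B%:E)%E ->
  (\int[L]_x G x (family_mid u v ^~ x) <= B%:E)%E.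
Proof.
move=> nu nv uB vB; have nm := nonneg_family_mid nu nv.
have mG := measurable_convex_integrand convG.
apply: (@le_trans _ _ (\int[L]_x ((G x (u ^~ x) + G x (v ^~ x)) * (2^-1)%:E))%E).
  apply: ge0_le_integral => //.
  - by move=> x _; exact: G_ge0.
  - exact: mG.
  - by apply: emeasurable_funM => //; apply: emeasurable_funD; exact: mG.
  - move=> x _; apply: convex_integrand_mid => // i; [by have [_] := nu i|].
    by have [_] := nv i.
rewrite ge0_integral_half; [|exact: mG|exact: mG|by move=> x; exact: G_ge0..].
by rewrite (splitr B) -mulrDl EFinM lee_wpmul2r ?lee_fin// EFinD leeD.
Qed.

Variable w : nat -> nat -> T -> R.
Hypothesis nw : forall m, nonneg_family (w m).

Lemma midhull_integral_convex_le (B : R) :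
  (\forall m \near \oo, (\int[L]_x G x (w m ^~ x) <= B%:E)%E) ->
  \forall k \near \oo, forall u, midhull family_mid w k u ->
    (\int[L]_x G x (u ^~ x) <= B%:E)%E.
Proof.
move=> wB; pose P u := nonneg_family u /\ (\int[L]_x G x (u ^~ x) <= B%:E)%E.
suff : \forall k \near \oo, forall u, midhull family_mid w k u -> P u.
  by apply: filterS => k Pk u /Pk[].
apply: midhull_near; last by apply: filterS wB => m; split.
move=> u v [nu uB] [nv vB]; split; first exact: nonneg_family_mid.
exact: integral_convex_mid_le.
Qed.

Lemma midhull_convex_fatou (v : nat -> nat -> T -> R) (v_lim : nat -> T -> R) (B : R) :
  (forall l, midhull family_mid w l (v l)) -> nonneg_family v_lim ->
  {ae L, forall x i, v l i x @[l --> \oo] --> v_lim i x} ->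
  (forall e : R, 0 < e -> \forall m \near \oo,
    (\int[L]_x G x (w m ^~ x) <= (B + e)%:E)%E) ->
  (\int[L]_x G x (v_lim ^~ x) <= B%:E)%E.
Proof.
move=> hv nv_lim v_cvg wB.
have nv l : nonneg_family (v l) := nonneg_family_midhull nw (hv l).
have mG := measurable_convex_integrand convG.
apply: (@le_trans _ _ (limn_einf (fun l => \int[L]_x G x (v l ^~ x)))%E).
  apply: integral_le_limn_einf => //; try by move=> *; [exact: mG|exact: G_ge0].
  - by move=> l; exact: mG.
  - by move=> l x; exact: G_ge0.
  - exact: mG.
  - by move=> x; exact: G_ge0.
  - apply: filterS v_cvg => x; apply: convex_integrand_lsc => // l i.
    by have [_] := nv l i.
apply/lee_addgt0Pr => e e0; apply: limn_einf_le.
by apply: filterS (midhull_integral_convex_le (wB e e0)) => l; exact.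
Qed.

End convex_integrands.

Definition superlinear (R : realType) (h : R -> \bar R) :=
  forall M, 0 < M -> exists2 t0, 0 <= t0 & forall t, t0 <= t -> ((M * t)%:E <= h t)%E.

Section uniform_integrability.
Context d (T : measurableType d) (R : realType) (mu : {finite_measure set T -> \bar R}).
Variable h : R -> \bar R.
Hypotheses (h_ge0 : forall t, (0 <= h t)%E) (h_lsc : lower_semicontinuous h).
Hypothesis h_superlinear : superlinear h.
Implicit Types (u : T -> R).

Let measurable_h u : measurable_fun setT u -> measurable_fun setT (fun x => h (u x)).
Proof.
by move=> mu_; apply: measurableT_comp => //; exact: lower_semicontinuous_measurable.
Qed.

Let nonneg_measurable_min u t : 0 <= t -> nonneg_measurable u ->
  nonneg_measurable (fun x => Num.min (u x) t).
Proof.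
move=> t0 [mu_ u0]; split=> [|x]; last by rewrite le_min u0.
exact: measurable_minr.
Qed.

(* Where [u] exceeds [t], it is at most [h u / M]. *)
Lemma superlinear_truncation (C e : R) : 0 < e -> exists2 t, 0 <= t &
  forall u, nonneg_measurable u -> (\int[mu]_x h (u x) <= C%:E)%E ->
    (\int[mu]_x (u x)%:E <= \int[mu]_x (Num.min (u x) t)%:E + e%:E)%E.
Proof.
move=> e0; pose M := (`|C| + 1) / e; have M0 : 0 < M by rewrite divr_gt0// ltr_pwDr.
have [t t0 ht] := h_superlinear M0; exists t => // u nu uC.
have [mu_ u0] := nu; have [mmin min0] := nonneg_measurable_EFin (nonneg_measurable_min t0 nu).
have mhu := measurable_h mu_.
apply: (@le_trans _ _ (\int[mu]_x ((Num.min (u x) t)%:E + (M^-1)%:E * h (u x)))%E).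
  apply: ge0_le_integral => //.
  - by move=> x _; rewrite lee_fin.
  - exact/measurable_EFinP.
  - by apply: emeasurable_funD => //; exact: emeasurable_funM.
  - move=> x _; have [ut|tu] := leP (u x) t.
      by rewrite leeDl// mule_ge0// lee_fin invr_ge0 ltW.
    rewrite -[leLHS]add0e leeD ?lee_fin//.
    by rewrite lee_pdivlMl// -EFinM; apply: ht; exact: ltW.
rewrite ge0_integralD//; last 2 first.
- by move=> x _; rewrite mule_ge0// lee_fin invr_ge0 ltW.
- exact: emeasurable_funM.
rewrite ge0_integralZl//; last by rewrite lee_fin invr_ge0 ltW.
rewrite leeD2l// lee_pdivrMl// -EFinM; apply: le_trans uC _.
by rewrite lee_fin divfK ?gt_eqF// (le_trans (ler_norm C))// lerDl.
Qed.

Let integral_min_fin_num u t : 0 <= t -> nonneg_measurable u ->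
  (\int[mu]_x (Num.min (u x) t)%:E)%E \is a fin_num.
Proof.
move=> t0 nu; have [mmin min0] := nonneg_measurable_EFin (nonneg_measurable_min t0 nu).
rewrite ge0_fin_numE ?integral_ge0//; apply: (@le_lt_trans _ _ (\int[mu]_x t%:E)%E).
  by apply: ge0_le_integral => // x _; rewrite lee_fin ge_min lexx orbT.
by rewrite integral_cst// lte_mul_pinfty// ltey_eq fin_num_measure.
Qed.

Lemma integral_min_cvg (u_ : nat -> T -> R) u t : 0 <= t ->
  (forall l, nonneg_measurable (u_ l)) -> nonneg_measurable u ->
  {ae mu, forall x, u_ l x @[l --> \oo] --> u x} ->
  (\int[mu]_x (Num.min (u_ l x) t)%:E @[l --> \oo] -->
   \int[mu]_x (Num.min (u x) t)%:E)%E.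
Proof.
move=> t0 nu_ nu u_cvg.
have nmin (w : T -> R) nw := nonneg_measurable_EFin (@nonneg_measurable_min w t t0 nw).
have [] := @dominated_convergence _ _ _ mu _ measurableT
  (fun l x => (Num.min (u_ l x) t)%:E) (fun x => (Num.min (u x) t)%:E) (cst t%:E) => //.
- by move=> l; have [] := nmin _ (nu_ l).
- by have [] := nmin _ nu.
- apply: filterS u_cvg => x u_x _; apply: cvg_EFin; first exact: nearW.
  have min_cont : {for u x, continuous (fun s : R => Num.min s t)}.
    by apply: continuous_min; [exact: cvg_id|exact: cvg_cst].
  exact: continuous_cvg min_cont u_x.
- apply/integrableP; split=> //; rewrite integral_cst// lte_mul_pinfty//.
  by rewrite ltey_eq fin_num_measure.
- apply: aeW => x l _; have [_ min0] := nmin _ (nu_ l).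
  by rewrite gee0_abs// lee_fin ge_min lexx orbT.
Qed.

Let integral_min_le u t : 0 <= t -> nonneg_measurable u ->
  (\int[mu]_x (Num.min (u x) t)%:E <= \int[mu]_x (u x)%:E)%E.
Proof.
move=> t0 nu; have [mu_ u0] := nonneg_measurable_EFin nu.
have [mmin min0] := nonneg_measurable_EFin (nonneg_measurable_min t0 nu).
by apply: ge0_le_integral => // x _; rewrite lee_fin ge_min lexx.
Qed.

Section superlinear_bound.
Variables (u_ : nat -> T -> R) (u : T -> R) (C : R).
Hypotheses (nu_ : forall l, nonneg_measurable (u_ l)) (nu : nonneg_measurable u).
Hypothesis u_cvg : {ae mu, forall x, u_ l x @[l --> \oo] --> u x}.
Hypothesis u_C : \forall l \near \oo, (\int[mu]_x h (u_ l x) <= C%:E)%E.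

Local Notation I w := (\int[mu]_x (w x)%:E)%E.

Let lim_C : (\int[mu]_x h (u x) <= C%:E)%E.
Proof.
apply: le_trans (limn_einf_le u_C); apply: integral_le_limn_einf => //.
- by move=> l; apply: measurable_h; have [] := nu_ l.
- by apply: measurable_h; have [] := nu.
- by apply: filterS u_cvg => x; exact: lower_semicontinuous_limn_einf.
Qed.

Let integral_lim_fin_num : I u \is a fin_num.
Proof.
have [_ u0] := nonneg_measurable_EFin nu; rewrite ge0_fin_numE ?integral_ge0//.
have [t t0 trunc] := superlinear_truncation C ltr01; apply: le_lt_trans (trunc u nu lim_C) _.
by rewrite lte_add_pinfty ?ltry// ltey_eq integral_min_fin_num.
Qed.

(* The truncations converge by dominated convergence, uniformly in the
   truncation error. *)
Lemma integral_cvg_of_superlinear : (I (u_ l) @[l --> \oo] --> I u)%E.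
Proof.
rewrite -(fineK integral_lim_fin_num); apply: cvge_of_near_le => e e0.
have e2 : 0 < e / 2 by rewrite divr_gt0.
have [t t0 trunc] := superlinear_truncation C e2.
have min_fin w := @integral_min_fin_num w t t0.
have := integral_min_cvg t0 nu_ nu u_cvg.
rewrite -(fineK (min_fin u nu)) => /fine_cvgP[_ /cvgrPdist_le/(_ _ e2)].
apply: filterS2 u_C => l ul_C; rewrite /= ler_distlC => /andP[lo hi].
rewrite EFinB EFinD fineK ?integral_lim_fin_num// leeBlDr// (splitr e) EFinD !addeA.
apply/andP; split.
  apply: le_trans (trunc _ nu lim_C) _; rewrite leeD2r//.
  apply: le_trans (leeD2r _ (integral_min_le t0 (nu_ l))).
  by rewrite -(fineK (min_fin u nu)) -(fineK (min_fin _ (nu_ l))) -EFinD lee_fin -lerBlDr.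
apply: le_trans (trunc _ (nu_ l) ul_C) _; rewrite leeD2r//.
apply: le_trans (leeD2r _ (integral_min_le t0 nu)).
by rewrite -(fineK (min_fin u nu)) -(fineK (min_fin _ (nu_ l))) -EFinD lee_fin.
Qed.

End superlinear_bound.

End uniform_integrability.

(** * Compactness of sequences and summable masses *)

Lemma ultra_fmap (T S : Type) (h : T -> S) (U : set_system T) :
  UltraFilter U -> UltraFilter (h @ U).
Proof.
move=> UU; split; first exact: fmap_proper_filter.
move=> G GF sG; rewrite predeqE => A; split; last exact: sG.
move=> GA; have [//|UC] := in_ultra_setVsetC (h @^-1` A) UU.
by have /sG GC : (h @ U) (~` A) by []; have [x []] := filter_ex (filterI GA GC).
Qed.

(* Limits of all the coordinates are taken along one ultrafilter, from which a
   sequence is then extracted diagonally. *)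
Lemma compact_cvg_subseq (R : realType) (M : pseudoMetricType R) (K : nat -> set M)
    (u : nat -> nat -> M) :
  (forall i, compact (K i)) -> (forall k i, K i (u k i)) ->
  exists ph : nat -> nat, exists l : nat -> M, (forall k, (k <= ph k)%N) /\
    forall i, K i (l i) /\ u (ph k) i @[k --> \oo] --> l i.
Proof.
move=> cK uK; have [U [UU sU]] := ultraFilterLemma eventually_filter.
have /choice[l Kl] i : exists l, K i l /\ u ^~ i @ U --> l.
  have UuU : UltraFilter (u ^~ i @ U) by exact: ultra_fmap.
  move: (cK i); rewrite compact_ultra => /(_ _ UuU)[|l [Kl ul]]; last by exists l.
  by apply: (@filterS _ U _ setT); [move=> k _; exact: uK|exact: filterT].
have /choice[ph phP] k : exists m, (k <= m)%N /\
    forall i : 'I_k.+1, ball (l i) k.+1%:R^-1 (u m i).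
  apply: (@filter_ex _ U); apply: filterI; first by apply: sU; exact: nbhs_infty_ge.
  apply: filter_forall => i; have k0 : 0 < k.+1%:R^-1 :> R by rewrite invr_gt0.
  by have [_ /cvg_ballP/(_ _ k0)] := Kl i.
exists ph, l; split=> [k|i]; first by have [] := phP k.
have [Kli _] := Kl i; split => //; apply/cvg_ballP => e e0; near=> k.
have ik : (i < k.+1)%N by rewrite ltnS; near: k; exact: nbhs_infty_ge.
have [_ /(_ (Ordinal ik)) uki] := phP k; apply: le_ball uki; apply: ltW.
by near: k; exact: near_infty_natSinv_lt (PosNum e0).
Unshelve. all: by end_near. Qed.

(* Masses of size about [2^-L] are fewer than [2^(L+1)] and are sent into the
   dyadic block [2^(L+1) - 1, 2^(L+2) - 1). *)
Section summable_code.
Context (T : choiceType) (R : realType) (m : T -> R).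
Hypothesis sum_m : forall s : seq T, uniq s -> \sum_(x <- s) m x <= 1.

Let level x : nat := trunc_log 2 (Num.truncn (m x)^-1).

Let level_bounds x : 0 < m x -> (2 ^ level x)%:R <= (m x)^-1 < (2 ^ (level x).+1)%:R.
Proof.
move=> mx0; have mx1 : 1 <= (m x)^-1.
  by rewrite invf_ge1//; have := sum_m (s := [:: x]) isT; rewrite big_seq1.
have n0 : (0 < Num.truncn (m x)^-1)%N by rewrite truncn_gt0.
apply/andP; split; last by rewrite -truncn_lt_nat ?(le_trans ler01)// trunc_log_ltn.
by rewrite -truncn_ge_nat ?(le_trans ler01)// trunc_logP.
Qed.

Let level_set k := [set x | 0 < m x /\ level x = k].

Let size_level k (s : seq T) : uniq s -> [set` s] `<=` level_set k ->
  (size s <= 2 ^ k.+1)%N.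
Proof.
move=> us sk; have pow0 : 0 < (2 ^ k.+1)%:R :> R by rewrite ltr0n expn_gt0.
rewrite -(ler_nat R) -[leRHS]mul1r -ler_pdivrMr//; apply: le_trans (sum_m us).
apply: (@le_trans _ _ (\sum_(x <- s) ((2 ^ k.+1)%:R)^-1)).
  by rewrite big_const_seq count_predT iter_addr_0 mulr_natl.
rewrite big_seq [leRHS]big_seq; apply: ler_sum => x /sk[mx0 <-].
have /andP[_ /ltW] := level_bounds mx0.
by rewrite -[(m x)^-1 <= _]lef_pV2 ?posrE ?invr_gt0// invrK.
Qed.

Let finite_level k : finite_set (level_set k).
Proof.
apply: contrapT => /(infinite_set_fset (2 ^ k.+1).+1)[B Bk].
by rewrite leqNgt ltnS size_level// finmap.fset_uniq.
Qed.

Let level_seq k : seq T := finmap.enum_fset (fset_set (level_set k)).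

Let mem_level_seq k x : (x \in level_seq k) = (x \in level_set k).
Proof. by rewrite /level_seq in_fset_set. Qed.

Let rank x : nat := index x (level_seq (level x)).

Let rank_lt x : 0 < m x -> (rank x < 2 ^ (level x).+1)%N.
Proof.
move=> mx0; have sub : [set` level_seq (level x)] `<=` level_set (level x).
  by move=> y /=; rewrite mem_level_seq inE.
apply: leq_trans (size_level (finmap.fset_uniq _) sub).
by rewrite index_mem mem_level_seq inE.
Qed.

Lemma summable_code : exists code : T -> nat,
  {in [set x | 0 < m x] &, injective code} /\
  forall x, 0 < m x -> m x * (code x).+1%:R <= 4.
Proof.
pose code1 x := (2 ^ (level x).+1 + rank x)%N.
have code1_gt0 x : (0 < code1 x)%N by rewrite addn_gt0 expn_gt0.
have code1_lt x : 0 < m x -> (code1 x < 2 ^ (level x).+2)%N.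
  by move=> mx0; rewrite [X in (_ < X)%N]expnS mul2n -addnn ltn_add2l rank_lt.
exists (fun x => (code1 x).-1); split=> [x y /[!inE] mx0 my0 /(congr1 succn)|x mx0].
  rewrite !prednK// => xy.
  have level_code z : 0 < m z -> trunc_log 2 (code1 z) = (level z).+1.
    by move=> mz0; apply: trunc_log_eq => //; rewrite leq_addr code1_lt.
  have lxy : level x = level y by apply: succn_inj; rewrite -!level_code// xy.
  move: xy; rewrite /code1 lxy => /addnI; rewrite /rank lxy.
  by apply: (index_inj x); rewrite mem_level_seq inE.
rewrite prednK//; have /andP[+ _] := level_bounds mx0.
rewrite -[_ <= (m x)^-1](ler_pM2l mx0) divff ?gt_eqF// => m_level.
apply: (@le_trans _ _ (m x * (2 ^ (level x).+2)%:R)).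
  by rewrite ler_pM2l// ler_nat ltnW// code1_lt.
by rewrite !expnS !natrM; lra.
Qed.

End summable_code.

Lemma cvg_nneseries_of_tails (R : realType) (a : nat -> nat -> R) (al : nat -> R) (s : R) :
  (forall k i, 0 <= a k i) -> (forall k, (\sum_(i <oo) (a k i)%:E = s%:E)%E) ->
  (forall e, 0 < e -> exists N, forall k, s - e <= \sum_(i < N) a k i) ->
  (forall i, a k i @[k --> \oo] --> al i) -> (\sum_(i <oo) (al i)%:E = s%:E)%E.
Proof.
move=> a0 a_s tails a_al.
have sum_cvg N : \sum_(i < N) a k i @[k --> \oo] --> \sum_(i < N) al i.
  by apply: cvg_big => [|i _]; [exact: add_continuous|exact: a_al].
have al0 i : 0 <= al i.
  rewrite -(cvg_lim (@Rhausdorff R) (a_al i)); apply: limr_ge; last exact: nearW.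
  by apply/cvg_ex; exists (al i).
apply/eqP; rewrite eq_le; apply/andP; split.
  apply: nneseries_le => [i|N]; first by rewrite lee_fin.
  rewrite sumEFin lee_fin -(cvg_lim (@Rhausdorff R) (sum_cvg N)); apply: limr_le.
    by apply/cvg_ex; exists (\sum_(i < N) al i).
  apply: nearW => k; rewrite -lee_fin -(a_s k) -sumEFin.
  by apply: partial_sum_le_nneseries => i; rewrite lee_fin.
apply/lee_addgt0Pr => e /tails[N tailN]; rewrite -leeBlDr// -EFinB.
apply: (@le_trans _ _ (\sum_(i < N) (al i)%:E)%E); last first.
  by apply: partial_sum_le_nneseries => i; rewrite lee_fin.
rewrite sumEFin lee_fin -(cvg_lim (@Rhausdorff R) (sum_cvg N)); apply: limr_ge.
  by apply/cvg_ex; exists (\sum_(i < N) al i).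
exact: nearW.
Qed.

Lemma cvg_itvcc (R : realType) (a : nat -> R) (l lo hi : R) :
  (forall k, lo <= a k <= hi) -> a k @[k --> \oo] --> l -> lo <= l <= hi.
Proof.
move=> a_itv a_l; have a_cvg : cvgn a by apply/cvg_ex; exists l.
rewrite -(cvg_lim (@Rhausdorff R) a_l); apply/andP; split.
  by apply: limr_ge => //; apply: nearW => k; have /andP[] := a_itv k.
by apply: limr_le => //; apply: nearW => k; have /andP[] := a_itv k.
Qed.

Section subadditive_mass.
Context (R : realType) (g : R -> \bar R).
Hypothesis g_ge0 : forall t : R, 0 <= t <= 1 -> (0 <= g t)%E.
Hypothesis g0 : g 0 = 0%E.

Lemma infinite_slope_near0 M : (g t * (t^-1)%:E)%E @[t --> 0^'+] --> +oo%E ->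
  exists2 dl, 0 < dl & forall t, 0 <= t <= dl -> ((M * t)%:E <= g t)%E.
Proof.
move=> /cvgeyPge/(_ M)[dl /= dl0 g_dl]; exists (dl / 2); first by rewrite divr_gt0.
move=> t; rewrite le_eqVlt => /andP[/predU1P[<- _|t0 tdl]].
  by rewrite mulr0 g0.
rewrite EFinM -lee_pdivlMr//; apply: (g_dl t) => //.
rewrite /ball_ /= sub0r normrN gtr0_norm//.
by apply: le_lt_trans tdl _; rewrite ltr_pdivrMr// ltr_pMr// ltr1n.
Qed.

(* The decay puts all late terms in the region where [g] is steep, so that their
   sum is controlled by [B]. *)
Lemma infinite_slope_uniform_tail (C B e : R) :
  (g t * (t^-1)%:E)%E @[t --> 0^'+] --> +oo%E -> 0 < B -> 0 < e ->
  exists N, forall (a : nat -> R) s, (forall i, 0 <= a i <= 1) ->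
    (forall i, a i * i.+1%:R <= C) -> (\sum_(i <oo) (a i)%:E = s%:E)%E ->
    (forall n, (\sum_(i < n) g (a i) <= B%:E)%E) -> s - e <= \sum_(i < N) a i.
Proof.
move=> g_steep B0 e0; have M0 : 0 < B / e by rewrite divr_gt0.
have [dl dl0 g_dl] := infinite_slope_near0 (B / e) g_steep.
pose N := Num.truncn (C / dl); exists N => a s a01 decay a_s gB.
have a0 i : 0 <= a i by have /andP[] := a01 i.
have ga i : (0 <= g (a i))%E by exact: g_ge0.
have small i : (N <= i)%N -> a i <= dl.
  move=> Ni; have i0 : (0 : R) < i.+1%:R by rewrite ltr0n.
  rewrite -(ler_pM2r i0); apply: le_trans (decay i) _.
  rewrite mulrC -ler_pdivrMr//; apply: ltW; apply: lt_le_trans (truncnS_gt _) _.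
  by rewrite ler_nat ltnS.
have tail n : \sum_(N <= i < n) a i <= e.
  rewrite -(ler_pM2l M0) divfK ?gt_eqF// -lee_fin mulr_sumr -sumEFin.
  apply: (@le_trans _ _ (\sum_(N <= i < n) g (a i))%E).
    rewrite big_nat_cond [leRHS]big_nat_cond; apply: lee_sum => i.
    by rewrite andbT => /andP[Ni _]; apply: g_dl; rewrite a0 small.
  apply: le_trans (gB n); have [nN|Nn] := leqP n N; first by rewrite big_geq ?sume_ge0.
  rewrite -(big_mkord xpredT (fun i => g (a i))) [leRHS](big_cat_nat _ (ltnW Nn))//=.
  by rewrite leeDr// sume_ge0.
rewrite lerBlDr -lee_fin -a_s; apply: nneseries_le => [i|n]; first by rewrite lee_fin.
rewrite sumEFin lee_fin -(big_mkord xpredT a) -(big_mkord xpredT a).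
have [nN|/ltnW Nn] := leqP n N.
  by rewrite [X in _ <= X + _](big_cat_nat _ nN)//= -addrA lerDl addr_ge0 ?sumr_ge0// ltW.
by rewrite (big_cat_nat _ Nn)//= lerD2l.
Qed.

Hypothesis g_lsc : lsc_on [set t : R | 0 <= t <= 1] g.

Lemma lsc_on_itv_limn_einf (a : nat -> R) (al : R) : (forall k, 0 <= a k <= 1) ->
  a k @[k --> \oo] --> al -> (g al <= limn_einf (fun k => g (a k)))%E.
Proof.
move=> a01 a_al; have al01 := cvg_itvcc a01 a_al.
apply: limn_einf_dense => r /(g_lsc al01)[V alV gV].
have nearV : \forall k \near \oo, V (a k) by exact: a_al alV.
by apply: filterS nearV => k /gV/(_ (a01 k))/ltW.
Qed.

Hypothesis g_sub : forall x y : R, 0 <= x -> 0 <= y -> x + y <= 1 ->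
  (g (x + y)%R <= g x + g y)%E.

Lemma subadditive_sum (a : nat -> R) N : (forall i, 0 <= a i) ->
  \sum_(i < N) a i <= 1 -> (g (\sum_(i < N) a i)%R <= \sum_(i < N) g (a i))%E.
Proof.
move=> a0; elim: N => [|N IH]; first by rewrite !big_ord0 g0.
rewrite !big_ord_recr /= => sum_le1.
have sum_ge0 : 0 <= \sum_(i < N) a i by apply: sumr_ge0.
apply: le_trans (g_sub sum_ge0 (a0 N) sum_le1) _.
by rewrite leeD2r// IH// (le_trans _ sum_le1)// lerDl.
Qed.

Lemma subadditive_series (a : nat -> R) (s : R) : (forall i, 0 <= a i) ->
  (\sum_(i <oo) (a i)%:E = s%:E)%E -> s <= 1 -> (g s <= \sum_(i <oo) g (a i))%E.
Proof.
move=> a0 a_s s1.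
have sum_le1 N : \sum_(i < N) a i <= 1.
  rewrite (le_trans _ s1)// -lee_fin -a_s -sumEFin.
  by apply: partial_sum_le_nneseries => i; rewrite lee_fin.
have ga i : (0 <= g (a i))%E.
  apply: g_ge0; rewrite a0 (le_trans _ (sum_le1 i.+1))// big_ord_recr /= lerDr.
  exact: sumr_ge0.
apply: le_trans (lsc_on_itv_limn_einf _ (cvg_partial_sum a0 a_s)) _.
  by move=> N; rewrite sumr_ge0//= sum_le1.
apply: limn_einf_le; apply: nearW => N; apply: le_trans (subadditive_sum a0 (sum_le1 N)) _.
exact: partial_sum_le_nneseries.
Qed.

End subadditive_mass.

(** * Euclidean space and energy densities *)

Lemma near_uniform_compact (R : realType) (X Y : topologicalType) (c : X * Y -> R)
    (K : set X) (y0 : Y) (e : R) : continuous c -> compact K -> 0 < e ->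
  \forall y \near y0, forall x, K x -> `|c (x, y) - c (x, y0)| <= e.
Proof.
move=> cc cK e0; move/compact_near_coveringP : cK => /(_ _ (nbhs y0)
  (fun y x => `|c (x, y) - c (x, y0)| <= e)); apply => x Kx.
have e2 : 0 < e / 2 by rewrite divr_gt0.
have [[U V] [/= xU y0V] UV] : \forall z \near (x, y0), `|c (x, y0) - c z| < e / 2.
  by have /cvgrPdist_lt/(_ _ e2) := cc (x, y0).
exists (U, V) => // -[x' y] [/= Ux' Vy].
have c_y : `|c (x, y0) - c (x', y)| < e / 2 by exact: UV.
have c_y0 : `|c (x, y0) - c (x', y0)| < e / 2.
  by apply: UV; split => //; exact: nbhs_singleton.
rewrite -(subrKA (c (x, y0))) (splitr e); apply: le_trans (ler_normD _ _) _.
by rewrite lerD// ltW// distrC.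
Qed.

Lemma continuous_abs_powR (R : realType) (p : R) : 0 < p ->
  continuous (fun t : R => `|t| `^ p).
Proof.
move=> p0 t; have [->|t0] := eqVneq t 0.
  apply/cvgrPdist_lt => e e0; near=> s.
  rewrite normr0 powR0 ?gt_eqF// sub0r normrN ger0_norm ?powR_ge0//.
  rewrite -[e in _ < e](powRr1 (ltW e0)) -(mulVf (lt0r_neq0 p0)) powRrM.
  rewrite gt0_ltr_powR// ?nnegrE ?powR_ge0//; near: s.
  by apply: (nbhs0_lt (V := R)); exact: powR_gt0.
have t1 : 0 < `|t| by rewrite normr_gt0.
have : expR (p * ln `|s|) @[s --> t] --> expR (p * ln `|t|).
  apply: continuous_cvg; first exact: continuous_expR.
  apply: cvgM; first exact: cvg_cst.
  by apply: continuous_cvg; [exact: continuous_ln|exact: norm_continuous].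
rewrite /continuous_at (_ : `|t| `^ p = expR (p * ln `|t|)); last by rewrite /powR gt_eqF.
apply: cvg_trans; apply: near_eq_cvg; near=> s.
rewrite /powR gt_eqF// normr_gt0; near: s.
by apply: (@cvgr_neq0 _ R _ _ _ id t) => //; exact: cvg_id.
Unshelve. all: by end_near. Qed.

Section euclidean_space.
Context (R : realType) (n : nat).
Implicit Types (A : set 'rV[R]_n) (x y : 'rV[R]_n).

Lemma open_measurable_Rn A : open A -> measurable (A : set (Rn R n)).
Proof. by move=> oA; exact: sub_sigma_algebra. Qed.

Lemma closed_measurable_Rn A : closed A -> measurable (A : set (Rn R n)).
Proof.
by move=> /closed_openC/open_measurable_Rn/measurableC; rewrite setCK.
Qed.

Lemma compact_measurable_Rn A : compact A -> measurable (A : set (Rn R n)).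
Proof.
move=> cA; apply: closed_measurable_Rn; apply: compact_closed cA.
exact: norm_hausdorff.
Qed.

Lemma measurable_set1_Rn x : measurable ([set x] : set (Rn R n)).
Proof. by apply: compact_measurable_Rn; exact: compact_set1. Qed.

Lemma continuous_measurable_Rn (h : 'rV[R]_n -> R) : continuous h ->
  measurable_fun (setT : set (Rn R n)) (h : Rn R n -> R).
Proof.
move=> ch; apply: (measurability _ (RGenOpens.measurableE R)).
move=> _ [_ [a [b ->]]] <-; rewrite setTI; apply: open_measurable_Rn.
by apply: open_comp => //; exact: interval_open.
Qed.

Lemma measurable_coord (i : 'I_n) :
  measurable_fun (setT : set (Rn R n)) (fun x : Rn R n => (x : 'rV[R]_n) ord0 i).
Proof. by apply: continuous_measurable_Rn; exact: coord_continuous. Qed.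

Lemma enorm_ge0 x : 0 <= enorm x.
Proof. exact: sqrtr_ge0. Qed.

Lemma measurable_enormB :
  measurable_fun setT (fun z : (Rn R n * Rn R n)%type =>
    enorm ((z.1 : 'rV[R]_n) - (z.2 : 'rV[R]_n))).
Proof.
apply: measurableT_comp.
  by apply: continuous_measurable_fun; exact: sqrt_continuous.
apply: measurable_sum => i; apply: measurable_funX.
under eq_fun do rewrite !mxE.
apply: measurable_funB.
  exact: (measurableT_comp (measurable_coord i) measurable_fst).
exact: (measurableT_comp (measurable_coord i) measurable_snd).
Qed.

Lemma continuous_enormB :
  continuous (fun z : 'rV[R]_n * 'rV[R]_n => enorm (z.1 - z.2)).
Proof.
move=> z; apply: (@continuous_comp _ _ _ _ (@Num.sqrt R)); last exact: sqrt_continuous.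
apply: cvg_big => [|i _]; first exact: add_continuous.
have subi_cont : {for z, continuous
    (fun z' : 'rV[R]_n * 'rV[R]_n => (z'.1 - z'.2) ord0 i)}.
  apply: (@continuous_comp _ _ _ (fun z' : 'rV[R]_n * 'rV[R]_n => z'.1 - z'.2)
    (fun x : 'rV[R]_n => x ord0 i)); last exact: coord_continuous.
  by apply: cvgB; [exact: cvg_fst|exact: cvg_snd].
by rewrite expr2; under eq_fun do rewrite expr2; exact: cvgM.
Qed.

Definition power_cost (p : R) x y : R := enorm (x - y) `^ p.

Lemma power_cost_ge0 p x y : 0 <= power_cost p x y. Proof. exact: powR_ge0. Qed.

Lemma measurable_power_cost p : measurable_fun setT
  (fun z : (Rn R n * Rn R n)%type => power_cost p z.1 z.2).
Proof. exact: (measurableT_comp (measurable_powR _) measurable_enormB). Qed.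

Lemma continuous_power_cost p : 0 < p ->
  continuous (fun z : 'rV[R]_n * 'rV[R]_n => power_cost p z.1 z.2).
Proof.
move=> p0 z.
have -> : (fun z : 'rV[R]_n * 'rV[R]_n => power_cost p z.1 z.2) =
    (fun t : R => `|t| `^ p) \o (fun z => enorm (z.1 - z.2)).
  by apply/funext => z'; rewrite /= ger0_norm ?enorm_ge0.
by apply: continuous_comp; [exact: continuous_enormB|exact: continuous_abs_powR].
Qed.

Lemma measurable_box (a b : 'rV[R]_n) : measurable (box a b).
Proof.
have -> : box a b = \bigcap_(i in [set: 'I_n])
    ((fun x : Rn R n => (x : 'rV[R]_n) ord0 i) @^-1` `[a ord0 i, b ord0 i]%classic).
  by apply/seteqP; split=> [x xab i _|x xab i]; have := xab i; rewrite /= in_itv//; exact.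
apply: fin_bigcap_measurable => // i _; rewrite -[X in measurable X]setTI.
by apply: measurable_coord => //; exact: measurable_itv.
Qed.

Lemma compact_sub_box A : compact A -> exists M, 0 <= M /\
  A `<=` box (const_mx (- M)) (const_mx M).
Proof.
move=> /compact_bounded[M [_ AM]]; exists (`|M| + 1); split; first by rewrite addr_ge0.
move=> x Ax i; rewrite !mxE -ler_norml.
apply: le_trans (AM _ _ x Ax); last by rewrite (le_lt_trans (ler_norm M))// ltrDl.
by rewrite [leRHS]mx_normrE; apply: (le_bigmax _ (fun ij => `|x ij.1 ij.2|) (ord0, i)).
Qed.

Lemma lebesgue_compact_lty (lam : {measure set (Rn R n) -> \bar R}) A :
  is_lebesgue lam -> compact A -> (lam A < +oo)%E.
Proof.
move=> lebesgue cA; have [M [M0 AM]] := compact_sub_box cA.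
apply: (@le_lt_trans _ _ (lam (box (const_mx (- M)) (const_mx M)))).
  by apply: le_measure; rewrite ?inE//; [exact: compact_measurable_Rn|exact: measurable_box].
rewrite lebesgue ?ltry// => i; rewrite !mxE.
by rewrite (le_trans _ M0)// oppr_le0.
Qed.

End euclidean_space.

Record energy_density (R : realType) (h : R -> \bar R) : Prop := EnergyDensity {
  energy_density_ge0 : forall t, (0 <= h t)%E;
  energy_density_nondecreasing : forall s t, s <= t -> (h s <= h t)%E;
  energy_density_lsc : lower_semicontinuous h;
  energy_density_mid : forall s t, 0 <= s -> 0 <= t ->
    (h ((s + t) / 2)%R <= (h s + h t) * (2^-1)%:E)%E;
  energy_density_superlinear : superlinear h }.

Lemma measurable_energy_density d (T : measurableType d) (R : realType)
    (h : R -> \bar R) (u : T -> R) : energy_density h -> measurable_fun setT u ->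
  measurable_fun setT (fun x => h (u x)).
Proof.
move=> h_dens mu; apply: measurableT_comp => //.
by apply: lower_semicontinuous_measurable; exact: energy_density_lsc.
Qed.

Section positive_part_extension.
Context (R : realType) (f : \bar R -> \bar R).

Definition posext (t : R) : \bar R := f (Num.max t 0)%:E.

Lemma posextE t : 0 <= t -> posext t = f t%:E.
Proof. by move=> t0; rewrite /posext max_l. Qed.

Hypothesis f_ge0 : forall x : \bar R, (0 <= x)%E -> (0 <= f x)%E.
Hypothesis f_lsc : lsc_on [set x : \bar R | (0 <= x)%E] f.
Hypothesis f_convex : forall (x y : \bar R) (t : R), (0 <= x)%E -> (0 <= y)%E ->
  0 <= t <= 1 -> (f (t%:E * x + (1 - t)%:E * y) <= t%:E * f x + (1 - t)%:E * f y)%E.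
Hypothesis f0 : f 0%E = 0%E.
Hypothesis f_superlinear : (f t%:E * (t^-1)%:E)%E @[t --> +oo] --> +oo%E.

Let max0_ge0 (t : R) : (0 <= (Num.max t 0)%:E)%E.
Proof. by rewrite lee_fin le_max lexx orbT. Qed.

Let posext_nondecreasing s t : s <= t -> (posext s <= posext t)%E.
Proof.
move=> st; have [s0|s0] := leP s 0; first by rewrite {1}/posext max_r// f0 f_ge0.
have t0 : 0 < t by exact: lt_le_trans st.
rewrite !posextE ?(ltW s0) ?(ltW t0)//.
have st1 : 0 <= s / t <= 1.
  by rewrite ler_pdivrMr// mul1r st andbT divr_ge0// ltW.
have t0' : (0 <= t%:E)%E by rewrite lee_fin ltW.
have := f_convex t0' (lexx 0%E) st1.
rewrite mule0 adde0 f0 mule0 adde0 -EFinM divfK ?gt_eqF// => /le_trans; apply.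
by rewrite -[leRHS]mul1e lee_wpmul2r ?f_ge0// lee_fin; case/andP: st1.
Qed.

Let posext_lsc : lower_semicontinuous posext.
Proof.
move=> t a /(f_lsc (max0_ge0 t))[V nV fV].
have max_cvg : (Num.max s 0)%:E @[s --> t] --> (Num.max t 0)%:E.
  apply: cvg_EFin; first exact: nearW.
  have max_cont : {for t, continuous (fun s : R => Num.max s 0)}.
    by apply: continuous_max; [exact: cvg_id|exact: cvg_cst].
  exact: max_cont.
exists [set s | V (Num.max s 0)%:E]; first exact: max_cvg.
by move=> s /= Vs; exact: fV Vs (max0_ge0 s).
Qed.

Let posext_mid s t : 0 <= s -> 0 <= t ->
  (posext ((s + t) / 2)%R <= (posext s + posext t) * (2^-1)%:E)%E.
Proof.
move=> s0 t0; rewrite !posextE ?divr_ge0 ?addr_ge0//.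
have half : 0 <= (2^-1 : R) <= 1 by apply/andP; split; lra.
have [s0' t0'] : (0 <= s%:E)%E /\ (0 <= t%:E)%E by rewrite !lee_fin.
have := f_convex s0' t0' half; rewrite (_ : 1 - 2^-1 = 2^-1 :> R); last by field.
rewrite -!EFinM -EFinD -mulrDr mulrC => /le_trans; apply.
by rewrite -ge0_muleDr ?f_ge0// muleC.
Qed.

Let posext_superlinear : superlinear posext.
Proof.
move=> M M0; have /cvgeyPge/(_ M)[A [_ f_ge]] := f_superlinear.
exists (Num.max (A + 1) 1) => [|t]; first by rewrite le_max ler01 orbT.
rewrite ge_max => /andP[At t1]; have t0 : 0 < t by exact: lt_le_trans t1.
rewrite posextE ?(ltW t0)// EFinM -lee_pdivlMr//; apply: f_ge.
by rewrite (lt_le_trans _ At)// ltrDl.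
Qed.

Lemma energy_density_posext : energy_density posext.
Proof. by split=> // t; exact: f_ge0. Qed.

End positive_part_extension.

(** * Atomic transport plans *)

Section atomic_plans.
Context d (T : measurableType d) (R : realType) (X : pseudoMetricType R).
Variables (L : {finite_measure set T -> \bar R}) (K : set X).

(* The transport plan [\sum_i (density i) L \x \d_(site i)]. *)
Record atomic_plan := AtomicPlan {
  site : nat -> X;
  density : nat -> T -> R;
  mass : nat -> R;
  site_in : forall i, K (site i);
  nonneg_density : nonneg_family density;
  integral_plan_density : forall i, (\int[L]_y (density i y)%:E = (mass i)%:E)%E;
  total_mass : (\sum_(i <oo) (mass i)%:E = 1)%E }.

Implicit Types (P : atomic_plan) (N : nat).

Lemma mass_ge0 P i : 0 <= mass P i.
Proof.
rewrite -lee_fin -integral_plan_density; apply: integral_ge0 => y _.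
by have [_ P0] := nonneg_density P i; rewrite lee_fin.
Qed.

Lemma sum_mass_le1 P N : \sum_(i < N) mass P i <= 1.
Proof.
rewrite -lee_fin -(total_mass P) -sumEFin.
by apply: partial_sum_le_nneseries => i; rewrite lee_fin mass_ge0.
Qed.

Lemma mass_itv P i : 0 <= mass P i <= 1.
Proof.
rewrite mass_ge0; apply: le_trans (sum_mass_le1 P i.+1).
by rewrite big_ord_recr /= lerDr sumr_ge0// => j _; exact: mass_ge0.
Qed.

Variables (c : T -> X -> R) (h : R -> \bar R) (g : R -> \bar R).

(* Only the first [N] atoms are charged: the energy of a plan is the supremum
   over [N], and the truncated costs converge uniformly along converging sites. *)
Definition plan_integrand N (x : nat -> X) (y : T) (z : nat -> R) : \bar R :=
  ((\sum_(i < N) c y (x i) * z i)%:E + h (\sum_(i < N) z i)%R)%E.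

Definition plan_energy N P : \bar R :=
  (\int[L]_y plan_integrand N (site P) y (density P ^~ y) +
   \sum_(i < N) g (mass P i))%E.

Hypothesis c_ge0 : forall y x, 0 <= c y x.
Hypothesis measurable_c : forall x, measurable_fun setT (c ^~ x).
Hypothesis h_dens : energy_density h.
Hypothesis g_ge0 : forall t : R, 0 <= t <= 1 -> (0 <= g t)%E.

Let h_ge0 := energy_density_ge0 h_dens.

Lemma sum_nonneg_family (u : nat -> T -> R) N : nonneg_family u ->
  nonneg_measurable (fun y => \sum_(i < N) u i y).
Proof.
move=> nu; split=> [|y]; last by apply: sumr_ge0 => i _; have [_] := nu i.
by apply: measurable_sum => i; have [] := nu i.
Qed.

Lemma integral_sum_density P N :
  (\int[L]_y (\sum_(i < N) density P i y)%:E = (\sum_(i < N) mass P i)%:E)%E.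
Proof.
have vP i := nonneg_measurable_EFin (nonneg_density P i).
under eq_integral do rewrite -sumEFin.
rewrite ge0_integral_sum//; [|by move=> i; have [] := vP i|by move=> i y _; have [_] := vP i].
by under eq_bigr do rewrite integral_plan_density; rewrite sumEFin.
Qed.

Lemma nonneg_cost_sum (x : nat -> X) (u : nat -> T -> R) N : nonneg_family u ->
  nonneg_measurable (fun y => \sum_(i < N) c y (x i) * u i y).
Proof.
move=> nu; split=> [|y].
  by apply: measurable_sum => i; apply: measurable_funM => //; have [] := nu i.
by apply: sumr_ge0 => i _; rewrite mulr_ge0//; have [_] := nu i.
Qed.

Lemma convex_plan_integrand N (x : nat -> X) : convex_integrand (plan_integrand N x).
Proof.
split.
- move=> y z z0; rewrite adde_ge0// lee_fin sumr_ge0// => i _.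
  by rewrite mulr_ge0.
- move=> y z z' z0 z'0; rewrite /plan_integrand addeACA ge0_muleDl; last 2 first.
  + by rewrite adde_ge0// lee_fin sumr_ge0// => i _; rewrite mulr_ge0.
  + exact: adde_ge0.
  apply: leeD.
    rewrite -EFinD -EFinM lee_fin -big_split mulr_suml /=.
    by apply: ler_sum => i _; rewrite -mulrDr mulrA.
  rewrite -mulr_suml big_split /=.
  by apply: energy_density_mid => //; apply: sumr_ge0.
- move=> y z zl z0 z_cvg.
  have cost_cvg : \sum_(i < N) c y (x i) * z l i @[l --> \oo] --> \sum_(i < N) c y (x i) * zl i.
    apply: cvg_big => [|i _]; first exact: add_continuous.
    by apply: cvgM => //; exact: cvg_cst.
  have sum_cvg : \sum_(i < N) z l i @[l --> \oo] --> \sum_(i < N) zl i.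
    by apply: cvg_big => [|i _]; [exact: add_continuous|exact: z_cvg].
  apply: le_trans (limn_einfD_ge0 _ _); last 2 first.
  + by move=> l; rewrite lee_fin sumr_ge0// => i _; rewrite mulr_ge0.
  + by [].
  have cost_cvgE : (\sum_(i < N) c y (x i) * z l i)%:E @[l --> \oo] -->
      (\sum_(i < N) c y (x i) * zl i)%:E by apply: cvg_EFin => //; exact: nearW.
  rewrite (cvg_limn_einf_sup cost_cvgE).1 leeD2l//.
  by apply: lower_semicontinuous_limn_einf sum_cvg; exact: energy_density_lsc.
- move=> u nu; apply: emeasurable_funD.
    by apply/measurable_EFinP; have [] := nonneg_cost_sum x N nu.
  by apply: measurable_energy_density => //; have [] := sum_nonneg_family N nu.
Qed.

Lemma plan_integrand_ge0 N x (u : nat -> T -> R) y : nonneg_family u ->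
  (0 <= plan_integrand N x y (u ^~ y))%E.
Proof.
move=> nu; apply: convex_integrand_ge0; first exact: convex_plan_integrand.
by move=> i; have [_] := nu i.
Qed.

Lemma measurable_plan_integrand N x (u : nat -> T -> R) : nonneg_family u ->
  measurable_fun setT (fun y => plan_integrand N x y (u ^~ y)).
Proof. exact: measurable_convex_integrand (convex_plan_integrand N x) _. Qed.

Lemma plan_energyE N P : plan_energy N P =
  (\sum_(i < N) \int[L]_y (c y (site P i) * density P i y)%:E +
   \int[L]_y h (\sum_(i < N) density P i y) + \sum_(i < N) g (mass P i))%E.
Proof.
have nP := nonneg_density P.
have [mcost cost0] := nonneg_measurable_EFin (nonneg_cost_sum (site P) N nP).
rewrite /plan_energy ge0_integralD//; last first.
  by apply: measurable_energy_density => //; have [] := sum_nonneg_family N nP.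
congr (_ + _ + _)%E; under eq_integral do rewrite -sumEFin.
rewrite ge0_integral_sum// => [i|i y _].
  by apply/measurable_EFinP/measurable_funM => //; have [] := nP i.
by rewrite lee_fin mulr_ge0//; have [_] := nP i.
Qed.

Lemma total_density_ex P : exists u, nonneg_measurable u /\
  {ae L, forall y, (\sum_(i <oo) (density P i y)%:E = (u y)%:E)%E}.
Proof.
have vP i := nonneg_measurable_EFin (nonneg_density P i).
pose S y := (\sum_(i <oo) (density P i y)%:E)%E.
have S0 y : (0 <= S y)%E by apply: nneseries_ge0 => i _ _; have [_] := vP i.
have mS : measurable_fun setT S.
  by apply: ge0_emeasurable_sum => [i y _ _|i _]; have [] := vP i.
exists (fine \o S); split; first by split=> [|y]; [exact: measurableT_comp|exact: fine_ge0].
have S_lty : (\int[L]_y S y < +oo)%E.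
  rewrite integral_nneseries//; last 2 first.
  - by move=> i; have [] := vP i.
  - by move=> i y _; have [_] := vP i.
  by under eq_eseriesr do rewrite integral_plan_density; rewrite total_mass ltry.
by apply: filterS (integral_lty_ae_fin_num mS S0 S_lty) => y /= Sy; rewrite fineK.
Qed.

Lemma total_energy_le P u (J : \bar R) : measurable_fun setT u ->
  {ae L, forall y, (\sum_(i <oo) (density P i y)%:E = (u y)%:E)%E} ->
  (forall N, (plan_energy N P <= J)%E) ->
  (\sum_(i <oo) \int[L]_y (c y (site P i) * density P i y)%:E +
   \int[L]_y h (u y) + \sum_(i <oo) g (mass P i) <= J)%E.
Proof.
move=> mu uE energy; have nP := nonneg_density P.
have cost_term_ge0 i : (0 <= \int[L]_y (c y (site P i) * density P i y)%:E)%E.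
  by apply: integral_ge0 => y _; have [_ P0] := nP i; rewrite lee_fin mulr_ge0.
have g_mass_ge0 i : (0 <= g (mass P i))%E by exact/g_ge0/mass_itv.
have partial_ge0 N : (0 <= \int[L]_y h (\sum_(i < N) density P i y)%R)%E.
  exact: integral_ge0.
have h_sum_le : (\int[L]_y h (u y) <=
    limn_einf (fun N => \int[L]_y h (\sum_(i < N) density P i y)%R))%E.
  apply: integral_le_limn_einf => //.
  - by move=> N; apply: measurable_energy_density => //; have [] := sum_nonneg_family N nP.
  - exact: measurable_energy_density.
  apply: filterS uE => y uy.
  apply: lower_semicontinuous_limn_einf; first exact: energy_density_lsc.
  by apply: cvg_partial_sum uy => i; have [_] := nP i.
apply: le_trans (leeD (leeD (nneseries_le_limn_einf cost_term_ge0) h_sum_le)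
  (nneseries_le_limn_einf g_mass_ge0)) _.
apply: (@le_trans _ _ (limn_einf (plan_energy ^~ P))); last first.
  by apply: limn_einf_le; exact: nearW.
under [in leRHS]eq_fun do rewrite plan_energyE.
apply: le_trans (limn_einfD_ge0 _ _); last 2 first.
- by move=> N; rewrite adde_ge0// sume_ge0.
- by move=> N; exact: sume_ge0.
rewrite leeD2r//; apply: limn_einfD_ge0 => // N; exact: sume_ge0.
Qed.

Lemma sum_g_le_plan_energy N P : (\sum_(i < N) g (mass P i) <= plan_energy N P)%E.
Proof.
rewrite leeDr//; apply: integral_ge0 => y _.
exact/plan_integrand_ge0/nonneg_density.
Qed.

Lemma integral_le_plan_energy N P :
  (\int[L]_y plan_integrand N (site P) y (density P ^~ y) <= plan_energy N P)%E.
Proof. by rewrite leeDl// sume_ge0// => i _; rewrite g_ge0// mass_itv. Qed.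

Lemma integral_h_le_plan_energy i P :
  (\int[L]_y h (density P i y) <= plan_energy i.+1 P)%E.
Proof.
apply: le_trans (integral_le_plan_energy i.+1 P).
have nP := nonneg_density P; have [mPi Pi0] := nP i.
apply: ge0_le_integral => //.
- exact: measurable_energy_density.
- exact: measurable_plan_integrand.
- move=> y _; rewrite -[leLHS]add0e leeD//.
    by have [_ c0] := nonneg_cost_sum (site P) i.+1 nP; rewrite lee_fin.
  apply: energy_density_nondecreasing => //; rewrite big_ord_recr /= lerDr.
  by have [_] := sum_nonneg_family i nP.
Qed.

Hypothesis c_unif : forall (x0 : X) (e : R), 0 < e -> \forall x \near x0,
  {ae L, forall y, `|c y x - c y x0| <= e}.

Lemma near_integral_plan_integrand N (x : nat -> nat -> X) (xl : nat -> X) (e : R) :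
  (forall i, x k i @[k --> \oo] --> xl i) -> 0 < e ->
  \forall k \near \oo, forall P,
    (\int[L]_y plan_integrand N xl y (density P ^~ y) <=
     \int[L]_y plan_integrand N (x k) y (density P ^~ y) + e%:E)%E.
Proof.
move=> x_cvg e0; have : \forall k \near \oo, forall i : 'I_N,
    {ae L, forall y, `|c y (x k i) - c y (xl i)| <= e}.
  by apply: filter_forall => i; exact: (x_cvg i) (c_unif (xl i) e0).
apply: filterS => k c_near P; have nP := nonneg_density P.
have [mS S0] := nonneg_measurable_EFin (sum_nonneg_family N nP).
have mI z := measurable_plan_integrand N z nP.
have I0 z y : (0 <= plan_integrand N z y (density P ^~ y))%E.
  exact: plan_integrand_ge0.
apply: (@le_trans _ _ (\int[L]_y (plan_integrand N (x k) y (density P ^~ y) +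
    e%:E * (\sum_(i < N) density P i y)%:E))%E).
  apply: ae_ge0_le_integral => //.
  - by move=> y _; rewrite adde_ge0// mule_ge0// lee_fin ltW.
  - by apply: emeasurable_funD => //; exact: emeasurable_funM.
  - have {}c_near : {ae L, forall y, forall i : 'I_N, `|c y (x k i) - c y (xl i)| <= e}.
      exact: filter_forall.
    apply: filterS c_near => y c_near _.
    rewrite -EFinM addeAC leeD2r// -EFinD lee_fin mulr_sumr -big_split /=.
    apply: ler_sum => i _; rewrite -mulrDl ler_wpM2r//; first by have [_] := nP i.
    by have := c_near i; rewrite ler_distl => /andP[]; rewrite lerBlDr.
rewrite ge0_integralD//; last 2 first.
- by move=> y _; rewrite mule_ge0// lee_fin ltW.
- exact: emeasurable_funM.
rewrite leeD2l// ge0_integralZl//; last by rewrite lee_fin ltW.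
by rewrite integral_sum_density -EFinM lee_fin ger_pMr// sum_mass_le1.
Qed.

Hypothesis g0 : g 0 = 0%E.
Hypothesis g_lsc : lsc_on [set t : R | 0 <= t <= 1] g.
Hypothesis g_steep : (g t * (t^-1)%:E)%E @[t --> 0^'+] --> +oo%E.

Section converging_plans.
Variables (P : nat -> atomic_plan) (xl : nat -> X) (al : nat -> R) (C J : R).
Hypothesis site_cvg : forall i, site (P k) i @[k --> \oo] --> xl i.
Hypothesis mass_cvg : forall i, mass (P k) i @[k --> \oo] --> al i.
Hypothesis decay : forall k i, mass (P k) i * i.+1%:R <= C.
Hypothesis energy : forall k N, (plan_energy N (P k) <= (J + k.+1%:R^-1)%:E)%E.

Let energy_bounded k N : (plan_energy N (P k) <= (`|J| + 1)%:E)%E.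
Proof.
apply: le_trans (energy k N) _; rewrite lee_fin lerD ?ler_norm//.
by rewrite invf_le1 ?ler1n// ltr0n.
Qed.

Let al_itv i : 0 <= al i <= 1.
Proof. exact: cvg_itvcc (fun k => mass_itv (P k) i) (@mass_cvg i). Qed.

Lemma total_mass_limit : (\sum_(i <oo) (al i)%:E = 1)%E.
Proof.
apply: (cvg_nneseries_of_tails (a := fun k => mass (P k))) => //.
- by move=> k; exact: mass_ge0.
- by move=> k; exact: total_mass.
move=> e e0; have B0 : 0 < `|J| + 1 by rewrite ltr_pwDr.
have [N tail] := infinite_slope_uniform_tail g_ge0 g0 C g_steep B0 e0.
exists N => k; apply: tail => // [i||n]; [exact: mass_itv|exact: total_mass|].
exact: le_trans (sum_g_le_plan_energy n (P k)) (energy_bounded k n).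
Qed.

Let w k := density (P k).

Let nonneg_w k : nonneg_family (w k).
Proof. exact: nonneg_density. Qed.

Variables (v : nat -> nat -> T -> R) (v_lim : nat -> T -> R).
Hypothesis v_hull : forall l, midhull family_mid w l (v l).
Hypothesis nonneg_v_lim : nonneg_family v_lim.
Hypothesis v_cvg : {ae L, forall y i, v l i y @[l --> \oo] --> v_lim i y}.

Let nonneg_v l : nonneg_family (v l).
Proof. exact: (nonneg_family_midhull nonneg_w (v_hull l)). Qed.

Let integral_v_cvg i : (\int[L]_y (v l i y)%:E @[l --> \oo] --> (al i)%:E)%E.
Proof.
pose near_al e (u : nat -> T -> R) := nonneg_family u /\
  ((al i - e)%:E <= \int[L]_y (u i y)%:E <= (al i + e)%:E)%E.
have near_v e : 0 < e -> \forall l \near \oo, near_al e (v l).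
  move=> e0; suff : \forall k \near \oo, forall u, midhull family_mid w k u -> near_al e u.
    by apply: filterS => l; exact.
  apply: midhull_near => [u u' [nu /andP[lo hi]] [nu' /andP[lo' hi']]|].
    split; first exact: nonneg_family_mid.
    rewrite integral_family_mid// (splitr (al i - e)) (splitr (al i + e)) -!mulrDl !EFinM.
    by rewrite !lee_wpmul2r ?lee_fin// EFinD leeD.
  have /cvgrPdist_le/(_ e e0) := @mass_cvg i; apply: filterS => k; rewrite ler_distlC.
  by move=> /andP[lo hi]; split=> //; rewrite integral_plan_density !lee_fin lo hi.
by apply: cvge_of_near_le => e e0; apply: filterS (near_v e e0) => l [].
Qed.

Lemma mass_limit i : (\int[L]_y (v_lim i y)%:E = (al i)%:E)%E.
Proof.
have convex_h : convex_integrand (fun (_ : T) z => h (z i)).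
  split=> // [_ z z' z0 z'0|_ z zl _ z_cvg|u nu].
  - exact: energy_density_mid.
  - by apply: lower_semicontinuous_limn_einf; [exact: energy_density_lsc|exact: z_cvg].
  - by apply: measurable_energy_density => //; have [] := nu i.
have hB : \forall m \near \oo, (\int[L]_y h (w m i y) <= (`|J| + 1)%:E)%E.
  by apply: nearW => m; exact: le_trans (integral_h_le_plan_energy i (P m)) (energy_bounded m i.+1).
apply: (cvg_unique (@ereal_hausdorff R) _ (@integral_v_cvg i)).
apply: (integral_cvg_of_superlinear h_ge0 (energy_density_lsc h_dens)
  (energy_density_superlinear h_dens) (C := `|J| + 1)).
- by move=> l; exact: nonneg_v.
- exact: nonneg_v_lim.
- by apply: filterS v_cvg => y; exact.
- by apply: filterS (midhull_integral_convex_le convex_h nonneg_w hB) => l; exact.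
Qed.

Lemma energy_limit N :
  (\int[L]_y plan_integrand N xl y (v_lim ^~ y) + \sum_(i < N) g (al i) <= J%:E)%E.
Proof.
apply: lee_adde_dense => [||r].
- by apply: integral_ge0 => y _; exact: plan_integrand_ge0.
- by apply: sume_ge0 => i _; exact/g_ge0/al_itv.
move=> lt_r; rewrite -leeBrDr// -EFinB.
apply: (midhull_convex_fatou (convex_plan_integrand N xl) nonneg_w v_hull nonneg_v_lim v_cvg).
move=> e e0; have e2 : 0 < e / 2 by rewrite divr_gt0.
have near_g : \forall m \near \oo, (r%:E < \sum_(i < N) g (mass (P m) i))%E.
  apply: near_lt_limn_einf; apply: lt_le_trans lt_r _.
  apply: le_trans (limn_einf_sum_ge0 _); last by move=> i k; rewrite g_ge0// mass_itv.
  by apply: lee_sum => i _; apply: lsc_on_itv_limn_einf => // k; exact: mass_itv.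
have near_inv : \forall m \near \oo, m.+1%:R^-1 < e / 2 := near_infty_natSinv_lt (PosNum e2).
apply: filterS3 near_g near_inv (near_integral_plan_integrand N site_cvg e2).
move=> m r_g inv_e /(_ (P m)) /le_trans; apply.
rewrite (_ : J - r + e = (J + e / 2 - r) + e / 2); last by field.
rewrite EFinD leeD2r// EFinB leeBrDr//.
apply: (@le_trans _ _ (plan_energy N (P m))); first by rewrite leeD2l// ltW.
by apply: le_trans (energy m N) _; rewrite lee_fin lerD2l ltW.
Qed.

End converging_plans.

Lemma atomic_plan_compact (P : nat -> atomic_plan) (C J : R) : compact K ->
  (forall k i, mass (P k) i * i.+1%:R <= C) ->
  (forall k N, (plan_energy N (P k) <= (J + k.+1%:R^-1)%:E)%E) ->
  exists Q, forall N, (plan_energy N Q <= J%:E)%E.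
Proof.
move=> cK decay energy.
have cKm (i : nat) : compact (K `*` `[0, 1]%classic : set (X * R)).
  by apply: compact_setX => //; exact: segment_compact.
have PK k i : (K `*` `[0, 1]%classic) (site (P k) i, mass (P k) i).
  by split=> /=; [exact: site_in|rewrite in_itv /= mass_itv].
have [ph [l [ph_ge l_cvg]]] := compact_cvg_subseq cKm PK.
have site_cvg i : site (P (ph k)) i @[k --> \oo] --> (l i).1.
  by have [_ lc] := l_cvg i; apply: cvg_comp lc cvg_fst.
have mass_cvg i : mass (P (ph k)) i @[k --> \oo] --> (l i).2.
  by have [_ lc] := l_cvg i; apply: cvg_comp lc cvg_snd.
have ph_energy k N : (plan_energy N (P (ph k)) <= (J + k.+1%:R^-1)%:E)%E.
  apply: le_trans (energy (ph k) N) _.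
  by rewrite lee_fin lerD2l lef_pV2 ?posrE ?ltr0n// ler_nat ltnS.
have ph_decay k i : mass (P (ph k)) i * i.+1%:R <= C by exact: decay.
have nw k := nonneg_density (P (ph k)).
have wB k i : (\int[L]_y (density (P (ph k)) i y)%:E <= 1%:E)%E.
  by rewrite integral_plan_density lee_fin; have /andP[] := mass_itv (P (ph k)) i.
have [v [v_lim [v_hull nv_lim v_cvg]]] := midhull_ae_cvg nw wB.
pose Q := AtomicPlan (fun i => (l_cvg i).1.1) nv_lim
  (mass_limit mass_cvg ph_energy v_hull nv_lim v_cvg)
  (total_mass_limit mass_cvg ph_decay ph_energy).
exists Q => N; exact: (energy_limit site_cvg mass_cvg ph_energy v_hull nv_lim v_cvg N).
Qed.

End atomic_plans.

(** * Disintegration of couplings *)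

Section slice_measure.
Context d1 d2 (T1 : measurableType d1) (T2 : measurableType d2) (R : realType).
Variables (gam : {finite_measure set (T1 * T2)%type -> \bar R}) (S : set T2).
Hypothesis mS : measurable S.

Definition slice_measure of measurable S := fun A : set T1 => gam (A `*` S).

Local Notation slice := (slice_measure mS).

Let slice0 : slice set0 = 0%E. Proof. by rewrite /slice_measure set0X measure0. Qed.

Let slice_ge0 A : (0 <= slice A)%E. Proof. exact: measure_ge0. Qed.

Let slice_sigma_additive : semi_sigma_additive slice.
Proof.
move=> F mF tF mUF; rewrite /slice_measure setX_bigcupl.
apply: measure_semi_sigma_additive => [i||]; first exact: measurableX.
- by move=> i j _ _ [z [[Fi _] [Fj _]]]; apply: tF => //; exists z.1.
- by rewrite -setX_bigcupl; exact: measurableX.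
Qed.

HB.instance Definition _ :=
  isMeasure.Build d1 T1 R slice slice0 slice_ge0 slice_sigma_additive.

Let slice_finite : fin_num_fun slice.
Proof. by move=> A mA; rewrite fin_num_measure//; exact: measurableX. Qed.

HB.instance Definition _ := Measure_isFinite.Build d1 T1 R slice slice_finite.

Lemma ge0_integral_slice_measure (h : T1 -> \bar R) :
  measurable_fun setT h -> (forall x, (0 <= h x)%E) ->
  (\int[slice]_x h x = \int[gam]_(z in [set: T1] `*` S) h z.1)%E.
Proof.
move=> mh h0; have mTS : measurable ([set: T1] `*` S) by exact: measurableX.
transitivity (\int[pushforward (mrestr gam mTS) fst]_x h x)%E.
  congr (integral _ _ _); apply/funext => A; congr (gam _).
  by apply/seteqP; split=> [z [Az Sz]|z [Az [_ Sz]]].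
rewrite ge0_integral_pushforward//.
by rewrite preimage_setT ge0_integral_mrestr//; [exact: measurableT_comp|move=> z /=].
Qed.

End slice_measure.

Section slice_densities.
Context d1 d2 (T1 : measurableType d1) (T2 : measurableType d2) (R : realType).
Variables (gam : {finite_measure set (T1 * T2)%type -> \bar R}).
Variables (L : {finite_measure set T1 -> \bar R}).

Definition slice_density (S : set T2) (w : T1 -> R) :=
  nonneg_measurable w /\
  forall A, measurable A -> gam (A `*` S) = (\int[L]_(x in A) (w x)%:E)%E.

Lemma slice_density_ex (S : set T2) : measurable S ->
  (forall A, measurable A -> L A = 0%E -> gam (A `*` setT) = 0%E) ->
  exists w, slice_density S w.
Proof.
move=> mS dom; have slice_L : slice_measure gam mS `<< L.
  apply/null_content_dominatesP => A mA LA; apply/eqP.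
  rewrite -measure_le0 -(dom A mA LA); apply: le_measure; rewrite ?inE.
  - exact: measurableX.
  - exact: measurableX.
  - exact: setSX.
have [w [w0 w_fin w_int wE]] := radon_nikodym_sigma_finite slice_L.
exists (fine \o w); split=> [|A mA].
  split=> [|x]; last exact: fine_ge0.
  by apply: measurableT_comp => //; exact: measurable_int w_int.
by rewrite [LHS](wE A mA); apply: eq_integral => x _; rewrite fineK.
Qed.

Lemma ge0_integral_slice_density (S : set T2) (w : T1 -> R) (h : T1 -> \bar R) :
  measurable S -> slice_density S w -> measurable_fun setT h -> (forall x, (0 <= h x)%E) ->
  (\int[L]_x (h x * (w x)%:E) = \int[gam]_(z in [set: T1] `*` S) h z.1)%E.
Proof.
move=> mS [nw wE] mh h0; rewrite -(ge0_integral_slice_measure _ mS)//.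
by rewrite (ge0_integral_density (mu := L) (nu := slice_measure gam mS) nw wE).
Qed.

Variables (D : nat -> set T2) (w : nat -> T1 -> R).
Hypotheses (mD : forall i, measurable (D i)) (tD : trivIset setT D).
Hypothesis wD : forall i, slice_density (D i) (w i).

Lemma ae_sum_slice_density (u : T1 -> R) : gam (setT `*` ~` \bigcup_i D i) = 0%E ->
  nonneg_measurable u ->
  (forall A, measurable A -> gam (A `*` setT) = (\int[L]_(x in A) (u x)%:E)%E) ->
  {ae L, forall x, (\sum_(i <oo) (w i x)%:E = (u x)%:E)%E}.
Proof.
move=> null_D nu uE; have [mu u0] := nonneg_measurable_EFin nu.
have wE i := nonneg_measurable_EFin (wD i).1.
have mUD : measurable (\bigcup_i D i) by exact: bigcup_measurable.
have gam_UD A : measurable A -> gam (A `*` setT) = gam (A `*` \bigcup_i D i).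
  move=> mA; have -> : A `*` setT = A `*` \bigcup_i D i `|` A `*` ~` \bigcup_i D i.
    apply/seteqP; split=> [z [Az _]|z [] [Az _]//].
    by have [Dz|nDz] := pselect ((\bigcup_i D i) z.2); [left|right].
  rewrite measureU; last 3 first.
  - exact: measurableX.
  - by apply: measurableX => //; exact: measurableC.
  - by apply/seteqP; split=> // z [[_ zD] [_ /=]].
  rewrite [X in (_ + X)%E](_ : _ = 0%E) ?adde0//; apply/eqP.
  rewrite -measure_le0 -null_D; apply: le_measure; rewrite ?inE; last exact: setSX.
  - by apply: measurableX => //; exact: measurableC.
  - by apply: measurableX => //; exact: measurableC.
have u_int : L.-integrable setT (EFin \o u).
  by apply: ge0_integrable => //; rewrite -uE// ltey_eq fin_num_measure//; exact: measurableX.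
suff : ae_eq L setT (EFin \o u) (fun x => \sum_(i <oo) (w i x)%:E)%E.
  by apply: filterS => x /(_ I).
apply: integral_ae_eq => //.
  by apply: ge0_emeasurable_sum => [i x _ _|i _]; [have [_] := wE i|have [] := wE i].
move=> A _ mA; rewrite -uE// gam_UD// integral_nneseries//; last 2 first.
- by move=> i; apply: measurable_funTS; have [] := wE i.
- by move=> i x _; have [_] := wE i.
under eq_eseriesr do rewrite -((wD _).2 A mA).
have mAD i : measurable (A `*` D i) by exact: measurableX.
rewrite setX_bigcupr measure_semi_bigcup//.
- by move=> i j _ _ [z [[_ Di] [_ Dj]]]; apply: tD => //; exists z.2.
- by rewrite -setX_bigcupr; exact: measurableX.
Qed.

Lemma sum_slice_cost_le (c : T1 -> T2 -> R) (y : nat -> T2) N :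
  (forall x z, 0 <= c x z) ->
  measurable_fun setT (fun z : T1 * T2 => c z.1 z.2) ->
  (forall i z, D i z -> z = y i) ->
  (\sum_(i < N) \int[L]_x (c x (y i) * w i x)%:E <= \int[gam]_z (c z.1 z.2)%:E)%E.
Proof.
move=> c0 mc Dy; have mTD i : measurable ([set: T1] `*` D i) by exact: measurableX.
have mcE : measurable_fun setT (fun z : T1 * T2 => (c z.1 z.2)%:E) by exact/measurable_EFinP.
have termE i : (\int[L]_x (c x (y i) * w i x)%:E =
    \int[gam]_(z in [set: T1] `*` D i) (c z.1 z.2)%:E)%E.
  under eq_integral do rewrite EFinM.
  rewrite (ge0_integral_slice_density (mD i) (wD i) (h := fun x => (c x (y i))%:E)).
  - by apply: eq_integral => z /set_mem[_ /Dy ->].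
  - apply/measurable_EFinP.
    exact: (measurableT_comp mc (pair2_measurable (y i))).
  - by move=> x; rewrite lee_fin.
under eq_bigr do rewrite termE.
rewrite -(big_mkord xpredT (fun i => \int[gam]_(z in [set: T1] `*` D i) (c z.1 z.2)%:E)%E).
rewrite -ge0_integral_bigsetU//.
- apply: ge0_subset_integral => //; first exact: bigsetU_measurable.
  by move=> z _; rewrite lee_fin.
- exact: iota_uniq.
- by move=> i j _ _ [z [[_ Di] [_ Dj]]]; apply: tD => //; exists z.2.
- exact: measurable_funTS.
- by move=> z _; rewrite lee_fin.
Qed.

End slice_densities.

Lemma fine_probability_itv d (T : measurableType d) (R : realType)
    (P : probability T R) (A : set T) : measurable A -> 0 <= fine (P A) <= 1.
Proof.
by move=> mA; rewrite fine_ge0//= -lee_fin fineK ?fin_num_measure// probability_le1.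
Qed.

Section atomic_partition.
Context (R : realType) (n : nat).
Local Notation T := (Rn R n).
Variables (nu : probability T R).

Let m (y : T) : R := fine (nu [set y]).

Let mset1 (y : T) : measurable [set y]. Proof. exact: measurable_set1_Rn. Qed.

Let atom_mass y : nu [set y] = (m y)%:E.
Proof. by rewrite fineK// fin_num_measure. Qed.

Let atomsE y : atoms nu y = (0 < m y) :> Prop.
Proof. by rewrite /atoms /= atom_mass lte_fin. Qed.

Let sum_atom_mass (s : seq T) : uniq s -> \sum_(y <- s) m y <= 1.
Proof.
move=> us; rewrite -lee_fin -sumEFin; under eq_bigr do rewrite -atom_mass.
rewrite fsbig_seq// -measure_fin_bigcup//.
- by apply: probability_le1; apply: fin_bigcup_measurable.
- by move=> y z _ _ [t [-> ->]].
Qed.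

Lemma atom_in (Om : set 'rV[R]_n) y : measurable (Om : set T) -> in_P Om nu ->
  atoms nu y -> Om y.
Proof.
move=> mOm nuOm atom_y; apply: contrapT => nOm_y; move: atom_y; rewrite /atoms /=.
suff -> : nu [set y] = 0%E by rewrite ltxx.
apply/eqP; rewrite -measure_le0 -nuOm; apply: le_measure; rewrite ?inE//.
  exact: measurableC.
by move=> _ ->.
Qed.

Lemma atomic_partition : nu (~` atoms nu) = 0%E -> exists D : nat -> set T,
  [/\ forall i, D i = set0 \/ exists2 y, atoms nu y & D i = [set y],
      trivIset setT D, \bigcup_i D i = atoms nu,
      (\sum_(i <oo) nu (D i) = 1)%E &
      forall i, fine (nu (D i)) * i.+1%:R <= 4].
Proof.
move=> nu_atomic; have [code [code_inj code_le]] := summable_code sum_atom_mass.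
pose D i := [set y : T | atoms nu y /\ code y = i].
have D01 i : D i = set0 \/ exists2 y, atoms nu y & D i = [set y].
  have [[y [ay yi]]|Di0] := pselect (exists y, D i y); last first.
    by left; apply/seteqP; split=> // y Diy; apply: Di0; exists y.
  right; exists y => //; apply/seteqP; split=> [z [az zi]|_ ->]; last by split.
  by apply: code_inj; [rewrite inE /= -atomsE..|rewrite zi].
have mD i : measurable (D i) by have [->|[y _ ->]] := D01 i.
have tD : trivIset setT D by move=> i j _ _ [y [[_ <-] [_ <-]]].
have UD : \bigcup_i D i = atoms nu.
  by apply/seteqP; split=> [y [i _ []]//|y ay]; exists (code y).
have matoms : measurable (atoms nu) by rewrite -UD; exact: bigcup_measurable.
exists D; split => //.
  rewrite -measure_semi_bigcup//; last by rewrite UD.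
  have := probability_setC nu matoms; rewrite nu_atomic UD => /esym/eqP.
  by rewrite sube_eq ?fin_num_measure// add0e => /eqP.
move=> i; have [->|[y ay Diy]] := D01 i; first by rewrite measure0 mul0r.
have code_y : code y = i by have [] : D i y by rewrite Diy.
by have := code_le y; rewrite code_y -atomsE Diy; exact.
Qed.

Lemma sum_atoms_le_esum (g : R -> \bar R) (D : nat -> set T) N : g 0 = 0%E ->
  (forall t : R, 0 <= t <= 1 -> (0 <= g t)%E) ->
  (forall i, D i = set0 \/ exists2 y, atoms nu y & D i = [set y]) ->
  trivIset setT D -> \bigcup_i D i = atoms nu ->
  (\sum_(i < N) g (fine (nu (D i))) <= \esum_(y in atoms nu) g (fine (nu [set y])))%E.
Proof.
move=> g0 g_ge0 D01 tD UD.
have g_atom0 y : (0 <= g (fine (nu [set y])))%E.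
  exact/g_ge0/fine_probability_itv.
have gDE i : (g (fine (nu (D i))) = \esum_(y in D i) g (fine (nu [set y])))%E.
  have [->|[y _ ->]] := D01 i; first by rewrite esum_set0 measure0.
  by rewrite esum_set1.
rewrite -UD nneseries_sum_bigcup//; under eq_bigr do rewrite gDE.
by apply: partial_sum_le_nneseries => i; exact: esum_ge0.
Qed.

End atomic_partition.

Lemma integral_energy_density_partial_sum_le d (T : measurableType d) (R : realType)
    (L : {measure set T -> \bar R}) (h : R -> \bar R) (w : nat -> T -> R) (u : T -> R) N :
  energy_density h -> nonneg_family w -> measurable_fun setT u ->
  {ae L, forall x, (\sum_(i <oo) (w i x)%:E = (u x)%:E)%E} ->
  (\int[L]_x h (\sum_(i < N) w i x)%R <= \int[L]_x h (u x))%E.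
Proof.
move=> h_dens nw mu w_u; have h_ge0 := energy_density_ge0 h_dens.
apply: ae_ge0_le_integral => //.
- by apply: measurable_energy_density => //; have [] := sum_nonneg_family N nw.
- exact: measurable_energy_density.
apply: filterS w_u => x w_ux _; apply: energy_density_nondecreasing => //.
rewrite -lee_fin -w_ux -sumEFin; apply: partial_sum_le_nneseries => i.
by have [_ w0] := nw i; rewrite lee_fin.
Qed.

Section disintegration.
Context (R : realType) (n : nat).
Local Notation T := (Rn R n).
Variables (Om : set 'rV[R]_n) (L : {finite_measure set T -> \bar R}).
Variables (c : T -> 'rV[R]_n -> R) (h g : R -> \bar R).
Hypothesis c_ge0 : forall x y, 0 <= c x y.
Hypothesis measurable_c : measurable_fun setT (fun z : T * T => c z.1 z.2).
Hypothesis h_dens : energy_density h.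
Hypothesis g_ge0 : forall t : R, 0 <= t <= 1 -> (0 <= g t)%E.
Hypothesis g0 : g 0 = 0%E.

Lemma atomic_plan_of_coupling (mu nu : probability T R)
    (gam : probability (T * T)%type R) (u : T -> R) :
  measurable (Om : set T) -> Om !=set0 -> in_P Om nu -> nu (~` atoms nu) = 0%E ->
  coupling mu nu gam -> nonneg_measurable u ->
  (forall A, measurable A -> mu A = (\int[L]_(x in A) (u x)%:E)%E) ->
  exists P : atomic_plan L Om, (forall i, mass P i * i.+1%:R <= 4) /\
    forall N, (plan_energy c h g N P <= \int[gam]_z (c z.1 z.2)%:E +
      \int[L]_x h (u x) + \esum_(y in atoms nu) g (fine (nu [set y])))%E.
Proof.
move=> mOm [x0 Ox0] nuOm nu_atomic [gam1 gam2] nu_u uE.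
have [D [D01 tD UD sum_D D_le]] := atomic_partition nu_atomic.
have mD i : measurable (D i).
  by have [->|[y _ ->]] := D01 i => //; exact: measurable_set1_Rn.
have /choice[x xP] i : exists x : T, Om x /\ forall z, D i z -> z = x.
  have [->|[y ay ->]] := D01 i; first by exists x0.
  by exists y; split=> //; exact: atom_in ay.
have gam_nu B : measurable B -> gam (setT `*` B) = nu B by move=> mB; rewrite setTX gam2.
have gam_mu A : measurable A -> gam (A `*` setT) = (\int[L]_(x in A) (u x)%:E)%E.
  by move=> mA; rewrite setXT gam1// uE.
have dom A : measurable A -> L A = 0%E -> gam (A `*` setT) = 0%E.
  move=> mA LA; rewrite gam_mu//; apply: null_set_integral => //.
  by apply/measurable_funTS/measurable_EFinP; have [] := nu_u.
have /choice[w wD] i := slice_density_ex (mD i) dom.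
have massE i : (\int[L]_y (w i y)%:E = (fine (nu (D i)))%:E)%E.
  by rewrite -(wD i).2// [LHS](gam_nu _ (mD i)) fineK// fin_num_measure.
have sum_mass : (\sum_(i <oo) (fine (nu (D i)))%:E = 1)%E.
  by rewrite -sum_D; apply: eq_eseriesr => i _; rewrite fineK// fin_num_measure.
exists (AtomicPlan (fun i => (xP i).1) (fun i => (wD i).1) massE sum_mass).
have mc y : measurable_fun setT (c ^~ y).
  exact: (measurableT_comp measurable_c (pair2_measurable (y : T))).
split=> // N; rewrite (plan_energyE g c_ge0 mc h_dens) /=; apply: leeD; [apply: leeD|].
- exact: (sum_slice_cost_le mD tD wD N c_ge0 measurable_c (fun i => (xP i).2)).
- have null_D : gam (setT `*` ~` \bigcup_i D i) = 0%E.
    rewrite [LHS](gam_nu _ (measurableC (bigcup_measurable (fun i _ => mD i)))).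
    by rewrite UD.
  exact: (integral_energy_density_partial_sum_le N h_dens (fun i => (wD i).1) nu_u.1
    (ae_sum_slice_density mD tD wD null_D nu_u gam_mu)).
- exact: (sum_atoms_le_esum N g0 g_ge0 D01 tD UD).
Qed.

End disintegration.

(** * From plans back to pairs of measures *)

Lemma probability_of_measure d (T : measurableType d) (R : realType)
    (m : {measure set T -> \bar R}) : m setT = 1%E ->
  exists P : probability T R, forall A, P A = m A.
Proof.
move=> m1; exists (mnormalize m (@dirac _ T point R)) => A.
by rewrite /= /mnormalize m1 onee_eq0 /= invr1 mule1.
Qed.

Section plan_of_densities.
Context d1 d2 (T1 : measurableType d1) (T2 : measurableType d2) (R : realType).
Variables (L : {finite_measure set T1 -> \bar R}) (w : nat -> T1 -> R) (x : nat -> T2).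
Variable (a : nat -> R).
Variable (u : T1 -> R).
Hypothesis nonneg_w : nonneg_family w.
Hypothesis integral_w : forall i, (\int[L]_y (w i y)%:E = (a i)%:E)%E.
Hypothesis sum_a : (\sum_(i <oo) (a i)%:E = 1)%E.
Hypothesis nonneg_u : nonneg_measurable u.
Hypothesis sum_w : {ae L, forall y, (\sum_(i <oo) (w i y)%:E = (u y)%:E)%E}.

Let integral_w_lty i : (\int[L]_y (w i y)%:E < +oo)%E.
Proof. by rewrite integral_w ltry. Qed.

Let w_measure i : {finite_measure set T1 -> \bar R} :=
  density_measure (nonneg_w i) (integral_w_lty i).

Let plan_measure : {measure set (T1 * T2)%type -> \bar R} :=
  mseries (fun i => w_measure i \x \d_(x i))%E 0.

Let plan_measureX A B : measurable A -> measurable B -> plan_measure (A `*` B) =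
  (\sum_(i <oo) \int[L]_(y in A) (w i y)%:E * \d_(x i) B)%E.
Proof.
by move=> mA mB; apply: eq_eseriesr => i _; rewrite /= [LHS]product_measure1E.
Qed.

Let sum_integral_w A : measurable A ->
  (\sum_(i <oo) \int[L]_(y in A) (w i y)%:E = \int[L]_(y in A) (u y)%:E)%E.
Proof.
move=> mA; have [mu u0] := nonneg_measurable_EFin nonneg_u.
have [mw w0] : (forall i, measurable_fun setT (EFin \o w i)) /\
    (forall i y, (0 <= (w i y)%:E)%E).
  by split=> i; have [] := nonneg_measurable_EFin (nonneg_w i).
rewrite -integral_nneseries//; last by move=> i; exact: measurable_funTS (mw i).
apply: ge0_ae_eq_integral => //.
- by apply: ge0_emeasurable_sum => // i _; exact: measurable_funTS (mw i).
- exact: measurable_funTS.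
- by move=> y _; exact: nneseries_ge0.
- by apply: filterS sum_w => y ->.
Qed.

Lemma plan_of_densities : exists gam : probability (T1 * T2)%type R,
  [/\ forall A, measurable A ->
        gam (A `*` setT) = (\int[L]_(y in A) (u y)%:E)%E,
      forall B, measurable B ->
        gam (setT `*` B) = (\sum_(i <oo) (a i)%:E * \d_(x i) B)%E &
      forall h, measurable_fun setT h -> (forall z, (0 <= h z)%E) ->
        (\int[gam]_z h z = \sum_(i <oo) \int[L]_y (h (y, x i) * (w i y)%:E))%E].
Proof.
have plan_fst A : measurable A -> plan_measure (A `*` setT) =
    (\sum_(i <oo) \int[L]_(y in A) (w i y)%:E)%E.
  by move=> mA; rewrite plan_measureX//; under eq_eseriesr do rewrite diracT mule1.
have [|gam gamE] := @probability_of_measure _ _ R plan_measure.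
  by rewrite -setXTT plan_fst// -sum_a; exact: eq_eseriesr.
exists gam; split=> [A mA|B mB|h mh h0]; first by rewrite gamE plan_fst// sum_integral_w.
  by rewrite gamE plan_measureX//; under eq_eseriesr do rewrite integral_w.
transitivity (\int[plan_measure]_z h z)%E.
  by apply: eq_measure_integral => A _ _; exact: gamE.
rewrite ge0_integral_measure_series//; apply: eq_eseriesr => i _.
have mhx : measurable_fun setT (fun y => h (y, x i)).
  exact: (measurableT_comp mh (pair2_measurable (x i))).
rewrite fubini_tonelli1//.
rewrite -(ge0_integral_density (nu := w_measure i) (nonneg_w i))//.
apply: eq_integral => y _; rewrite [LHS]integral_dirac ?diracT ?mul1e//.
exact: (measurableT_comp mh (pair1_measurable y)).
Qed.

End plan_of_densities.

Lemma esum_fiber (R : realType) (I J : choiceType) (x : I -> J) (A : set J)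
    (b : I -> \bar R) : (forall i, (0 <= b i)%E) ->
  (\esum_(y in A) \esum_(i in x @^-1` [set y]) b i = \esum_(i in x @^-1` A) b i)%E.
Proof.
move=> b0; rewrite (esum_esum (a := fun _ i => b i))//.
have fiberE : x @^-1` A = snd @` (A `*`` (fun y => x @^-1` [set y])).
  by apply/seteqP; split=> [i Ai|_ [[y i] [/= Ay xi] <-]]; [exists (x i, i)|rewrite /= xi].
rewrite fiberE esum_image// => -[y i] [y' j]; rewrite !inE => -[/= _ <-] [/= _ <-].
by move=> ->.
Qed.

Section series_of_diracs.
Context (R : realType) (n : nat).
Local Notation T := (Rn R n).
Variables (nu : probability T R) (x : nat -> T) (a : nat -> R).
Hypothesis a_ge0 : forall i, 0 <= a i.
Hypothesis nuE : forall B, measurable B -> nu B = (\sum_(i <oo) (a i)%:E * \d_(x i) B)%E.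

Let mset1 (y : T) : measurable [set y]. Proof. exact: measurable_set1_Rn. Qed.

Let nu_set1 y : nu [set y] = (\sum_(i <oo) (if x i == y then a i else 0)%:E)%E.
Proof.
rewrite nuE//; apply: eq_eseriesr => i _; rewrite diracE classical_sets.in_set1.
by case: eqP; rewrite ?mule1 ?mule0.
Qed.

Let fiber_ge0 y i : 0 <= (if x i == y then a i else 0).
Proof. by case: ifP. Qed.

Let le_nu_site i : ((a i)%:E <= nu [set x i])%E.
Proof.
rewrite nu_set1; have := @nneseries_ge_term _ (fun j => (if x j == x i then a j else 0)%:E) i.
by rewrite eqxx; apply=> j; rewrite lee_fin.
Qed.

Let atomsE : atoms nu = \bigcup_(i in [set i | 0 < a i]) [set x i].
Proof.
apply/seteqP; split=> [y|_ [i /= ai ->]]; rewrite /atoms /=; last first.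
  exact: lt_le_trans (le_nu_site i).
rewrite nu_set1; apply: contraPP => no_i; rewrite eseries0 ?ltxx// => i _ _.
case: eqP => // xi; congr EFin; apply: le_anti; rewrite a_ge0 andbT leNgt.
by apply/negP => ai; apply: no_i; exists i.
Qed.

Lemma series_of_diracs_atomic : nu (~` atoms nu) = 0%E.
Proof.
have matoms : measurable (atoms nu) by rewrite atomsE; exact: bigcup_measurable.
rewrite nuE; last exact: measurableC.
apply: eseries0 => i _ _; have [ai|ai] := ltP 0 (a i).
  rewrite diracE memNset ?mule0//= => atom_xi; apply: atom_xi.
  by rewrite atomsE; exists i.
by rewrite (_ : a i = 0) ?mul0e//; apply: le_anti; rewrite ai a_ge0.
Qed.

Variable g : R -> \bar R.
Hypothesis g_ge0 : forall t : R, 0 <= t <= 1 -> (0 <= g t)%E.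
Hypothesis g_sub : forall s t : R, 0 <= s -> 0 <= t -> s + t <= 1 ->
  (g (s + t)%R <= g s + g t)%E.
Hypothesis g_lsc : lsc_on [set t : R | 0 <= t <= 1] g.
Hypothesis g0 : g 0 = 0%E.

Lemma Gfun_series_of_diracs_le : (Gfun g nu <= \sum_(i <oo) g (a i))%E.
Proof.
have a_le1 i : a i <= 1.
  by rewrite -lee_fin (le_trans (le_nu_site i))// probability_le1.
have ga i : (0 <= g (a i))%E by rewrite g_ge0// a_ge0 a_le1.
rewrite /Gfun series_of_diracs_atomic eqxx nneseries_esumT//.
apply: (@le_trans _ _ (\esum_(i in x @^-1` atoms nu) g (a i))%E); last first.
  by rewrite esum_mkcond; apply: le_esum => i _; case: ifP.
rewrite -(esum_fiber x)//; apply: le_esum => y _.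
have -> : (\esum_(i in x @^-1` [set y]) g (a i) =
    \sum_(i <oo) g (if x i == y then a i else 0%R))%E.
  rewrite (_ : _ @^-1` _ = [set i | x i == y]); last by apply/seteqP; split=> i /= /eqP.
  rewrite -(nneseries_esum (P := fun i => x i == y))// eseries_mkcond.
  by apply: eq_eseriesr => i _; case: ifP.
apply: subadditive_series => //; first by rewrite -nu_set1 fineK// fin_num_measure.
by have /andP[] := fine_probability_itv nu (mset1 y).
Qed.

End series_of_diracs.

Section plans_and_pairs.
Context (R : realType) (n : nat).
Local Notation T := (Rn R n).
Variables (Om : set 'rV[R]_n) (p : R) (lam : {measure set T -> \bar R}).
Variables (f : \bar R -> \bar R) (g : R -> \bar R).
Hypotheses (mOm : measurable (Om : set T)) (lamOm : (lam (Om : set T) < +oo)%E).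
Hypothesis f_ge0 : forall x : \bar R, (0 <= x)%E -> (0 <= f x)%E.
Hypothesis posext_dens : energy_density (posext f).
Hypothesis g_ge0 : forall t : R, 0 <= t <= 1 -> (0 <= g t)%E.
Hypothesis g0 : g 0 = 0%E.

Local Notation L := (mfrestr mOm lamOm).
Local Notation cost := (power_cost p : T -> 'rV[R]_n -> R).
Local Notation energy := (plan_energy cost (posext f) g).

Let L_setC : L (~` (Om : set T)) = 0%E.
Proof. by rewrite /mfrestr /mrestr setICl measure0. Qed.

Let measurable_cost x : measurable_fun setT (cost ^~ x).
Proof. exact: (measurableT_comp (measurable_power_cost p) (pair2_measurable (x : T))). Qed.

Let cost_integral_ge0 (gam : probability (T * T)%type R) :
  (0 <= \int[gam]_z (cost z.1 z.2)%:E)%E.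
Proof. by apply: integral_ge0 => z _; rewrite lee_fin power_cost_ge0. Qed.

Let energy_integral_ge0 (mu : probability T R) u : is_density Om lam mu u ->
  (0 <= \int[lam]_(y in (Om : set T)) f (u y)%:E)%E.
Proof. by move=> [_ u0 _ _]; apply: integral_ge0 => y Oy; rewrite f_ge0// lee_fin u0. Qed.

Let Tp_ge0 (mu nu : probability T R) : (0 <= Tp p mu nu)%E.
Proof. by apply: le_ereal_inf_tmp => _ [gam _ <-]; exact: cost_integral_ge0. Qed.

Let Ffun_ge0 (mu : probability T R) : (0 <= Ffun Om lam f mu)%E.
Proof. by apply: le_ereal_inf_tmp => _ [u du <-]; exact: energy_integral_ge0 du. Qed.

Let Gfun_ge0 (nu : probability T R) : (0 <= Gfun g nu)%E.
Proof.
rewrite /Gfun; case: ifP => // _; apply: esum_ge0 => y _; apply: g_ge0.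
by apply: fine_probability_itv; exact: measurable_set1_Rn.
Qed.

Lemma Fp_ge0 (mu nu : probability T R) : (0 <= Fp Om p lam f g mu nu)%E.
Proof. by rewrite !adde_ge0 ?Tp_ge0 ?Ffun_ge0 ?Gfun_ge0. Qed.

Lemma is_density_patch (mu : probability T R) (u : T -> R) : is_density Om lam mu u ->
  [/\ nonneg_measurable (u \_ (Om : set T)),
      forall A, measurable A -> mu A = (\int[L]_(y in A) ((u \_ (Om : set T)) y)%:E)%E &
      (\int[L]_y posext f ((u \_ (Om : set T)) y) =
       \int[lam]_(y in (Om : set T)) f (u y)%:E)%E].
Proof.
move=> [mu_u u0 _ uE].
have nu_u : nonneg_measurable (u \_ (Om : set T)).
  split; first exact/(measurable_restrictT _ mOm).
  by move=> y; rewrite patchE; case: ifPn => // /set_mem /u0.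
have [mpatch patch0] := nonneg_measurable_EFin nu_u.
split=> // [A mA|].
  rewrite uE// ge0_integral_mrestr_in//.
  by apply: eq_integral => y /set_mem[_ Oy]; rewrite patchE mem_set.
rewrite ge0_integral_mrestr//; last 2 first.
- by apply: measurable_energy_density; last exact: nu_u.1.
- by move=> y; exact: energy_density_ge0.
by apply: eq_integral => y yO; rewrite patchE yO posextE// u0//; exact: set_mem.
Qed.

Lemma near_minimal_plan (mu nu : probability T R) (r : R) : Om !=set0 -> in_P Om nu ->
  (Fp Om p lam f g mu nu < r%:E)%E ->
  exists P : atomic_plan L Om, (forall i, mass P i * i.+1%:R <= 4) /\
    forall N, (energy N P <= r%:E)%E.
Proof.
move=> Om0 nuOm; rewrite /Fp -addeA => /lt_ereal_infD[||_ [gam cpl <-]].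
- by move=> _ [gam _ <-]; exact: cost_integral_ge0.
- by rewrite adde_ge0.
rewrite addeCA => /lt_ereal_infD[||_ [u du <-]].
- by move=> _ [u du <-]; exact: energy_integral_ge0 du.
- by rewrite adde_ge0// cost_integral_ge0.
have [cost0 fu0] := (cost_integral_ge0 gam, energy_integral_ge0 du).
rewrite addeCA addeA => lt_r.
have : (Gfun g nu < +oo)%E.
  by apply: lt_trans (ltry r); apply: le_lt_trans lt_r; rewrite leeDr// adde_ge0.
rewrite /Gfun in lt_r *; case: eqP lt_r => // nu_atomic lt_r _.
have [nu_u uE fuE] := is_density_patch du.
have [P [decay P_le]] := atomic_plan_of_coupling (@power_cost_ge0 R n p)
  (measurable_power_cost p) posext_dens g_ge0 g0 mOm Om0 nuOm nu_atomic cpl nu_u uE.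
exists P; split=> // N; apply: le_trans (P_le N) _; rewrite fuE; exact: ltW.
Qed.

Lemma Ffun_le_density (mu : probability T R) (u : T -> R) : nonneg_measurable u ->
  (forall A, measurable A -> mu A = (\int[L]_(y in A) (u y)%:E)%E) ->
  (Ffun Om lam f mu <= \int[L]_y posext f (u y))%E.
Proof.
move=> nu_u uE; have [mu_u u0] := nu_u; have [mu_uE u0E] := nonneg_measurable_EFin nu_u.
have muE A : measurable A -> mu A = (\int[lam]_(y in A `&` (Om : set T)) (u y)%:E)%E.
  by move=> mA; rewrite uE// ge0_integral_mrestr_in.
rewrite ge0_integral_mrestr//; last 2 first.
- exact: measurable_energy_density.
- by move=> y; exact: energy_density_ge0.
apply: ereal_inf_lbound; exists u; last by apply: eq_integral => y _; rewrite posextE.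
split=> //; first exact: measurable_funTS.
apply/integrableP; split; first exact: measurable_funTS.
under eq_integral do rewrite /= ger0_norm//.
by have := muE _ measurableT; rewrite setTI => <-; rewrite probability_setT ltry.
Qed.

Hypothesis g_sub : forall s t : R, 0 <= s -> 0 <= t -> s + t <= 1 ->
  (g (s + t)%R <= g s + g t)%E.
Hypothesis g_lsc : lsc_on [set t : R | 0 <= t <= 1] g.

Lemma pair_of_plan (P : atomic_plan L Om) (J : \bar R) :
  (forall N, (energy N P <= J)%E) -> exists mu nu : probability T R,
    [/\ in_P Om mu, in_P Om nu & (Fp Om p lam f g mu nu <= J)%E].
Proof.
move=> P_le; have [u [nu_u uE]] := total_density_ex P.
have nP := nonneg_density P; have a0 := mass_ge0 P.
have [gam [gam_fst gam_snd gam_int]] := plan_of_densities (site P : nat -> T) nP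
  (integral_plan_density P) (total_mass P) nu_u uE.
pose mu : probability T R := distribution gam (mfun_Sub (mem_set measurable_fst)).
pose nu : probability T R := distribution gam (mfun_Sub (mem_set measurable_snd)).
have muE A : measurable A -> mu A = (\int[L]_(y in A) (u y)%:E)%E.
  by move=> mA; rewrite -gam_fst// setXT.
have nuE B : measurable B -> nu B = (\sum_(i <oo) (mass P i)%:E * \d_(site P i : T) B)%E.
  by move=> mB; rewrite -gam_snd// setTX.
exists mu, nu; split.
- rewrite /in_P muE; last exact: measurableC.
  apply: null_set_integral; [exact: measurableC| |exact: L_setC].
  by apply: measurable_funTS; have [] := nonneg_measurable_EFin nu_u.
- rewrite /in_P nuE; last exact: measurableC.
  apply: eseries0 => i _ _; rewrite diracE memNset ?mule0//.
  by move=> /(_ (site_in P i)).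
have total_le := total_energy_le (power_cost_ge0 p : forall y x, 0 <= cost y x)
  measurable_cost posext_dens g_ge0 nu_u.1 uE P_le.
apply: le_trans total_le.
apply: leeD; last exact: (Gfun_series_of_diracs_le a0 nuE g_ge0 g_sub g_lsc g0).
apply: leeD; last exact: Ffun_le_density.
apply: (@le_trans _ _ (\int[gam]_z (cost z.1 z.2)%:E)%E).
  by apply: ereal_inf_lbound; exists gam.
rewrite gam_int; last 2 first.
- by apply/measurable_EFinP; exact: measurable_power_cost.
- by move=> z; rewrite lee_fin power_cost_ge0.
by under eq_eseriesr do under eq_integral do rewrite -EFinM.
Qed.

Local Notation pairs := [set m : probability T R * probability T R |
  in_P Om m.1 /\ in_P Om m.2].
Local Notation pair_energy := (fun m => Fp Om p lam f g m.1 m.2).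

Hypotheses (cOm : compact Om) (Om0 : Om !=set0) (p_gt0 : 0 < p).

Lemma near_power_cost (x0 : 'rV[R]_n) (e : R) : 0 < e ->
  \forall x \near x0, {ae L, forall y, `|cost y x - cost y x0| <= e}.
Proof.
move=> e0; have cost_cont := @continuous_power_cost R n p p_gt0.
apply: filterS (near_uniform_compact x0 cost_cont cOm e0) => x near_x.
exists (~` (Om : set T)); split; [exact: measurableC|exact: L_setC|].
by move=> y /= far_y Oy; apply: far_y; exact: near_x.
Qed.

Hypothesis g_steep : (g t * (t^-1)%:E)%E @[t --> 0^'+] --> +oo%E.

Lemma pair_energy_attained (J : R) :
  (forall e : R, 0 < e -> exists2 m, pairs m & (pair_energy m < (J + e)%:E)%E) ->
  exists2 m, pairs m & (pair_energy m <= J%:E)%E.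
Proof.
move=> near_J; have /choice[P P_min] k : exists P : atomic_plan L Om,
    (forall i, mass P i * i.+1%:R <= 4) /\
    forall N, (energy N P <= (J + k.+1%:R^-1)%:E)%E.
  have [|[mu nu] [_ nuOm]] := near_J k.+1%:R^-1; first by rewrite invr_gt0 ltr0n.
  exact: near_minimal_plan.
have [Q Q_min] := atomic_plan_compact (power_cost_ge0 p : forall y x, 0 <= cost y x)
  measurable_cost posext_dens g_ge0 near_power_cost g0 g_lsc g_steep cOm
  (fun k => (P_min k).1) (fun k => (P_min k).2).
by have [mu [nu [muOm nuOm munu_J]]] := pair_of_plan Q_min; exists (mu, nu).
Qed.

End plans_and_pairs.

Theorem theorem2p1 (R : realType) (n : nat) (Om : set 'rV[R]_n) (p : R)
    (lam : {measure set (Rn R n) -> \bar R})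
    (f : \bar R -> \bar R) (g : R -> \bar R) :
  is_lebesgue lam ->
  compact Om -> Om !=set0 ->
  1 <= p ->
  (* f : [0,+oo] -> [0,+oo], lsc, convex, f(0) = 0, superlinear *)
  (forall x : \bar R, (0 <= x)%E -> (0 <= f x)%E) ->
  lsc_on [set x : \bar R | (0 <= x)%E] f ->
  (forall (x y : \bar R) (t : R), (0 <= x)%E -> (0 <= y)%E -> 0 <= t <= 1 ->
     (f (t%:E * x + (1 - t)%:E * y) <= t%:E * f x + (1 - t)%:E * f y)%E) ->
  f 0%E = 0%E ->
  (f t%:E * (t^-1)%:E)%E @[t --> +oo] --> +oo%E ->
  (* g : [0,1] -> [0,+oo], subadditive, lsc, g(0) = 0, g(t)/t -> +oo at 0+ *)
  (forall t : R, 0 <= t <= 1 -> (0 <= g t)%E) ->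
  (forall x y : R, 0 <= x -> 0 <= y -> x + y <= 1 -> (g (x + y)%R <= g x + g y)%E) ->
  lsc_on [set t : R | 0 <= t <= 1] g ->
  g 0 = 0%E ->
  (g t * (t^-1)%:E)%E @[t --> 0^'+] --> +oo%E ->
  exists mu nu : probability (Rn R n) R,
    [/\ in_P Om mu, in_P Om nu &
        forall mu' nu' : probability (Rn R n) R, in_P Om mu' -> in_P Om nu' ->
          (Fp Om p lam f g mu nu <= Fp Om p lam f g mu' nu')%E].
Proof.
move=> lebesgue cOm Om0 p1 f_ge0 f_lsc f_convex f0 f_slope g_ge0 g_sub g_lsc g0 g_steep.
have p0 : 0 < p by exact: lt_le_trans p1.
have mOm := compact_measurable_Rn cOm; have lamOm := lebesgue_compact_lty lebesgue cOm.
have posext_dens := energy_density_posext f_ge0 f_lsc f_convex f0 f_slope.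
pose E (m : probability (Rn R n) R * probability (Rn R n) R) := Fp Om p lam f g m.1 m.2.
have [|m|J near_J|[mu nu] [muOm nuOm] min_E] :=
  @direct_method R _ [set m | in_P Om m.1 /\ in_P Om m.2] E.
- have [x0 Ox0] := Om0; pose delta : probability (Rn R n) R := @dirac _ (Rn R n) x0 R.
  by exists (delta, delta); split; rewrite /in_P /= diracE memNset// => /(_ Ox0).
- exact: Fp_ge0.
- exact: (pair_energy_attained mOm lamOm f_ge0 posext_dens g_ge0).
- by exists mu, nu; split=> // mu' nu' mu'Om nu'Om; exact: (min_E (mu', nu')).
Qed.
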